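(* For every $n\ge 4$, there exists a non-homotopic $n$-vertex connected quasiplanar graph with exactly $8n-20$ edges.
   Context: Graphs are finite and have no loops, but may have parallel edges. A drawing on the sphere $\mathbb{S}^2$ maps vertices to pairwise distinct points and each edge to a simple Jordan arc joining its endpoints, such that no edge passes through a vertex, any two edges have finitely many common points, every common interior point of two edges is a proper crossing, and no three edges pass through the same crossing. A drawing is quasiplanar if no three edges pairwise cross. A lens is a region bounded by a simple closed curve consisting of exactly two contiguous parts, each being (a part of) a single edge (e.g. two uncrossed parallel edges, parts of two adjacent edges that cross, or parts of two edges crossing more than once); a drawing is non-homotopic if every lens contains a vertex or a crossing in its interior. A non-homotopic quasiplanar graph is a graph admitting a drawing that is both non-homotopic and quasiplanar. *)

(* Defs.v *)
From Stdlib Require Import Reals List.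
From mathcomp Require Import all_boot.

Set Implicit Arguments.
Unset Strict Implicit.
Unset Printing Implicit Defensive.

(* Finite loopless multigraphs on vertex set 'I_n with m edges 'I_m;   *)
(* edge e joins (ends e).1 and (ends e).2 (parallel edges allowed).    *)

Definition loopless (n m : nat) (ends : 'I_m -> 'I_n * 'I_n) : Prop :=
  forall e : 'I_m, (ends e).1 <> (ends e).2.

Definition adj (n m : nat) (ends : 'I_m -> 'I_n * 'I_n) : rel 'I_n :=
  fun u v => [exists e : 'I_m, (ends e == (u, v)) || (ends e == (v, u))].

Definition mconnected (n m : nat) (ends : 'I_m -> 'I_n * 'I_n) : Prop :=
  forall u v : 'I_n, connect (adj ends) u v.

Section Geometry.
Local Open Scope R_scope.

Definition pt : Type := (R * R * R)%type.

Definition S2 (x : pt) : Prop :=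
  let '(a, b, c) := x in a ^ 2 + b ^ 2 + c ^ 2 = 1.

Definition d3 (x y : pt) : R :=
  let '(a, b, c) := x in let '(a', b', c') := y in
  sqrt ((a - a') ^ 2 + (b - b') ^ 2 + (c - c') ^ 2).

Definition d2 (x y : R * R) : R :=
  sqrt ((fst x - fst y) ^ 2 + (snd x - snd y) ^ 2).

Definition d1 (x y : R) : R := Rabs (x - y).

Definition cont_on {A B : Type} (dA : A -> A -> R) (dB : B -> B -> R)
  (S : A -> Prop) (f : A -> B) : Prop :=
  forall x, S x -> forall eps, 0 < eps ->
    exists del, 0 < del /\
      forall y, S y -> dA x y < del -> dB (f x) (f y) < eps.

Definition I01 (t : R) : Prop := 0 <= t <= 1.

Definition jordan_arc (g : R -> pt) (p q : pt) : Prop :=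
  cont_on d1 d3 I01 g /\
  (forall s t, I01 s -> I01 t -> g s = g t -> s = t) /\
  (forall t, I01 t -> S2 (g t)) /\
  g 0 = p /\ g 1 = q.

Definition on_arc (g : R -> pt) (x : pt) : Prop :=
  exists t, I01 t /\ g t = x.

Definition interior_pt (g : R -> pt) (x : pt) : Prop :=
  exists t, 0 < t < 1 /\ g t = x.

Definition disk2 (z : R * R) : Prop := fst z ^ 2 + snd z ^ 2 < 1.

Definition rel_open (U : pt -> Prop) : Prop :=
  (forall x, U x -> S2 x) /\
  (forall x, U x -> exists eps, 0 < eps /\
      forall y, S2 y -> d3 x y < eps -> U y).

Definition proper_crossing (g1 g2 : R -> pt) (x : pt) : Prop :=
  exists (U : pt -> Prop) (h : pt -> R * R) (k : R * R -> pt),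
    rel_open U /\ U x /\
    cont_on d3 d2 U h /\ cont_on d2 d3 disk2 k /\
    (forall y, U y -> disk2 (h y) /\ k (h y) = y) /\
    (forall z, disk2 z -> U (k z) /\ h (k z) = z) /\
    h x = (0, 0) /\
    (forall y, U y -> (on_arc g1 y <-> snd (h y) = 0)) /\
    (forall y, U y -> (on_arc g2 y <-> fst (h y) = 0)).

End Geometry.

Section Drawings.
Local Open Scope R_scope.
Variables (n m : nat) (ends : 'I_m -> 'I_n * 'I_n).
Variables (vpos : 'I_n -> pt) (arc : 'I_m -> R -> pt).

Definition is_drawing : Prop :=
  (forall v, S2 (vpos v)) /\
  (forall u v, vpos u = vpos v -> u = v) /\
  (forall e, jordan_arc (arc e) (vpos (ends e).1) (vpos (ends e).2)) /\
  (forall e w t, 0 < t < 1 -> arc e t <> vpos w) /\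
  (forall e f, e <> f -> exists l : list pt,
      forall x, on_arc (arc e) x -> on_arc (arc f) x -> List.In x l) /\
  (forall e f x, e <> f -> interior_pt (arc e) x -> interior_pt (arc f) x ->
      proper_crossing (arc e) (arc f) x) /\
  (forall e f g x, e <> f -> f <> g -> e <> g ->
      ~ (interior_pt (arc e) x /\ interior_pt (arc f) x /\
         interior_pt (arc g) x)).

Definition crossing_at (e f : 'I_m) (x : pt) : Prop :=
  e <> f /\ interior_pt (arc e) x /\ interior_pt (arc f) x.

Definition cross (e f : 'I_m) : Prop := exists x, crossing_at e f x.

Definition quasiplanar : Prop :=
  forall e f g : 'I_m, ~ (cross e f /\ cross f g /\ cross e g).

Definition lens_curve (C : pt -> Prop) : Prop :=
  exists (e f : 'I_m) (a1 a2 b1 b2 : R),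
    e <> f /\
    0 <= a1 /\ a1 < a2 /\ a2 <= 1 /\
    0 <= b1 /\ b1 < b2 /\ b2 <= 1 /\
    ((arc e a1 = arc f b1 /\ arc e a2 = arc f b2) \/
     (arc e a1 = arc f b2 /\ arc e a2 = arc f b1)) /\
    (forall s t, a1 <= s <= a2 -> b1 <= t <= b2 -> arc e s = arc f t ->
       s = a1 \/ s = a2) /\
    (forall x, C x <->
       ((exists s, a1 <= s <= a2 /\ arc e s = x) \/
        (exists t, b1 <= t <= b2 /\ arc f t = x))).

Definition same_region (C : pt -> Prop) (y0 y : pt) : Prop :=
  exists phi : R -> pt,
    cont_on d1 d3 I01 phi /\
    (forall t, I01 t -> S2 (phi t) /\ ~ C (phi t)) /\
    phi 0 = y0 /\ phi 1 = y.

(* every lens (= every region of S^2 bounded by such a curve C, i.e. every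
   component of S^2 \ C) contains a vertex or a crossing in its interior *)
Definition non_homotopic : Prop :=
  forall C : pt -> Prop, lens_curve C ->
  forall y0 : pt, S2 y0 -> ~ C y0 ->
    exists y, same_region C y0 y /\
      ((exists w, y = vpos w) \/ (exists e f, crossing_at e f y)).

End Drawings.

(* Main.v *)
Require Import Defs.
From Stdlib Require Import Reals.
From mathcomp Require Import all_boot.
From Stdlib Require Import Lra Psatz Classical.
From mathcomp Require Import zify.
(* [Reals] also declares a [d1]. *)
Import Defs.

Set Implicit Arguments.
Unset Strict Implicit.
Unset Printing Implicit Defensive.

(* Put the vertices on the equator at the even ones of 2n cyclically ordered points
   P 0, ..., P (2n - 1), and draw each hemisphere as a disc in which edges are straight
   chords. Capoyleas and Pach: a convex n-gon has 3n - 10 diagonals no three of which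
   pairwise cross, for instance all diagonals at two consecutive vertices and all the
   diagonals (a, a + 2). Draw these in both hemispheres, and the n sides in the northern one;
   for every i add an edge from i to i + 3 that runs in the north from P (2i) to P (2i + 3)
   and then in the south to P (2i + 6). Altogether 2(3n - 10) + n + n = 8n - 20 edges.
   Inside a hemisphere two chords cross only if their ends are interlaced, so
   quasiplanarity is a statement about indices.
   A lens meets each open hemisphere in one chord, in two disjoint chords, or in two
   pieces of chords issuing from a corner. Hence every point off the lens can be moved
   along a straight segment of its disc to a vertex on the same side of these chords.
   For n = 4 one sometimes has to cross the equator first. *)

Local Open Scope R_scope.

(** * Continuity *)

(** The step from [i] to [i + 3] is what makes the additional edges harmless. The northern half of
    edge [i] cuts off the single vertex [i + 1], the southern half the single vertex [i + 2], so the
    chords that cross it in one hemisphere all share an end. Edges [i] and [j] of this kind cross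
    only if [i] and [j] are cyclically consecutive; a chord crossing [i] in the north ends at
    [i + 1], where edge [i + 1] starts, and a chord crossing [i + 1] in the south ends at [i + 3],
    where edge [i] ends. The equator is left at odd points so that no vertex is hit and no two edges
    change hemisphere at the same point. A side is drawn only once because two copies of it would
    bound a lens without vertex. Only the cyclic order of the points matters, so they are chosen
    with rational coordinates: the side of a chord on which a point lies is then the sign of a
    product of differences of indices. The hard part is non-homotopy: every component of the
    complement of every lens curve must receive an explicit path to a vertex, for arbitrary [n]. *)

Section Continuity.
Variables (A : Type) (dA : A -> A -> R) (S : A -> Prop).

Lemma cont_on_ext (B : Type) (dB : B -> B -> R) (f g : A -> B) :
  (forall x, S x -> f x = g x) -> cont_on dA dB S f -> cont_on dA dB S g.
Proof.
move=> fg cf x Sx eps e0; have [d [d0 H]] := cf x Sx eps e0.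
by exists d; split=> // y Sy xy; rewrite -!fg //; exact: H.
Qed.

Lemma cont_on_const (c : R) : cont_on dA d1 S (fun=> c).
Proof.
move=> x _ eps e0; exists 1; split; first lra.
by move=> y _ _; rewrite /d1 Rminus_diag Rabs_R0.
Qed.

Lemma cont_on_comp (f : A -> R) (g : R -> R) :
  (forall x, S x -> continuity_pt g (f x)) ->
  cont_on dA d1 S f -> cont_on dA d1 S (fun x => g (f x)).
Proof.
move=> cg cf x Sx eps e0.
have [al [al0 Hal]] := cg x Sx eps e0.
have [d [d0 H]] := cf x Sx al al0.
exists d; split=> // y Sy xy.
rewrite /d1 Rabs_minus_sym.
have [->|ne] := Req_dec (f y) (f x); first by rewrite Rminus_diag Rabs_R0.
apply: Hal; split; first by split; [exact: I | exact: not_eq_sym].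
by rewrite /= /Rdist Rabs_minus_sym; exact: H.
Qed.

Lemma cont_on_add (f g : A -> R) :
  cont_on dA d1 S f -> cont_on dA d1 S g -> cont_on dA d1 S (fun x => f x + g x).
Proof.
move=> cf cg x Sx eps e0.
have [d [d0 Hd]] := cf x Sx (eps / 2) ltac:(lra).
have [d' [d0' Hd']] := cg x Sx (eps / 2) ltac:(lra).
exists (Rmin d d'); split; first exact: Rmin_pos.
move=> y Sy xy.
have /(Hd _ Sy) := Rlt_le_trans _ _ _ xy (Rmin_l d d').
have /(Hd' _ Sy) := Rlt_le_trans _ _ _ xy (Rmin_r d d').
by rewrite /d1; split_Rabs; lra.
Qed.

Lemma cont_on_sqr (f : A -> R) :
  cont_on dA d1 S f -> cont_on dA d1 S (fun x => f x * f x).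
Proof.
by apply: (@cont_on_comp f (fun y => y * y)) => x _; apply: derivable_continuous_pt; reg.
Qed.

Lemma cont_on_scale (c : R) (f : A -> R) :
  cont_on dA d1 S f -> cont_on dA d1 S (fun x => c * f x).
Proof.
by apply: (@cont_on_comp f (fun y => c * y)) => x _; apply: derivable_continuous_pt; reg.
Qed.

Lemma d2_lt (u v : R * R) (eps : R) : 0 < eps ->
  d1 (fst u) (fst v) < eps / 2 -> d1 (snd u) (snd v) < eps / 2 -> d2 u v < eps.
Proof.
rewrite /d1 /d2 => e0 h1 h2.
apply: (Rlt_le_trans _ (sqrt (eps ^ 2))); last by rewrite sqrt_pow2; lra.
apply: sqrt_lt_1_alt.
move: (fst u - fst v) (snd u - snd v) h1 h2 => p q; split; first nra.
by split_Rabs; nra.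
Qed.

Lemma d3_lt (u v : pt) (eps : R) : 0 < eps ->
  d2 (fst u) (fst v) < eps / 2 -> d1 (snd u) (snd v) < eps / 2 -> d3 u v < eps.
Proof.
case: u v => [[a b] c] [[a' b'] c']; rewrite /d1 /d2 /d3 /= => e0 h1 h2.
apply: (Rlt_le_trans _ (sqrt (eps ^ 2))); last by rewrite sqrt_pow2; lra.
apply: sqrt_lt_1_alt.
move: (a - a') (b - b') (c - c') h1 h2 => p q r h1 h2; split; first nra.
have s0 : 0 <= p ^ 2 + q ^ 2 by nra.
have s1 := sqrt_sqrt _ s0; have s2 := sqrt_pos (p ^ 2 + q ^ 2).
rewrite -s1; move: (sqrt _) s2 h1 => s s2 h1.
by move: h2; split_Rabs; nra.
Qed.

Lemma cont_on_pair2 (f g : A -> R) :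
  cont_on dA d1 S f -> cont_on dA d1 S g -> cont_on dA d2 S (fun x => (f x, g x)).
Proof.
move=> cf cg x Sx eps e0.
have [d [d0 Hd]] := cf x Sx (eps / 2) ltac:(lra).
have [d' [d0' Hd']] := cg x Sx (eps / 2) ltac:(lra).
exists (Rmin d d'); split; first exact: Rmin_pos.
move=> y Sy xy; apply: d2_lt => //=.
  exact/Hd/(Rlt_le_trans _ _ _ xy)/Rmin_l.
exact/Hd'/(Rlt_le_trans _ _ _ xy)/Rmin_r.
Qed.

Lemma cont_on_pair3 (f : A -> R * R) (g : A -> R) :
  cont_on dA d2 S f -> cont_on dA d1 S g -> cont_on dA d3 S (fun x => (f x, g x)).
Proof.
move=> cf cg x Sx eps e0.
have [d [d0 Hd]] := cf x Sx (eps / 2) ltac:(lra).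
have [d' [d0' Hd']] := cg x Sx (eps / 2) ltac:(lra).
exists (Rmin d d'); split; first exact: Rmin_pos.
move=> y Sy xy; apply: d3_lt => //=.
  exact/Hd/(Rlt_le_trans _ _ _ xy)/Rmin_l.
exact/Hd'/(Rlt_le_trans _ _ _ xy)/Rmin_r.
Qed.

End Continuity.

Lemma cont_on_id (S : R -> Prop) : cont_on d1 d1 S (fun x => x).
Proof. by move=> x _ eps e0; exists eps. Qed.

Lemma d2_ge_fst (u v : R * R) : d1 (fst u) (fst v) <= d2 u v.
Proof.
rewrite /d1 /d2 -sqrt_Rsqr_abs; apply: sqrt_le_1_alt; rewrite /Rsqr.
by move: (fst u - fst v) (snd u - snd v) => p q; nra.
Qed.

Lemma d2_ge_snd (u v : R * R) : d1 (snd u) (snd v) <= d2 u v.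
Proof.
rewrite /d1 /d2 -sqrt_Rsqr_abs; apply: sqrt_le_1_alt; rewrite /Rsqr.
by move: (fst u - fst v) (snd u - snd v) => p q; nra.
Qed.

Lemma d3_ge_fst (u v : pt) : d2 (fst u) (fst v) <= d3 u v.
Proof.
case: u v => [[a b] c] [[a' b'] c'] /=; rewrite /d2 /=.
by apply: sqrt_le_1_alt; move: (c - c') => p; nra.
Qed.

Lemma cont_on_fst2 (S : R * R -> Prop) : cont_on d2 d1 S fst.
Proof.
move=> x _ eps e0; exists eps; split=> // y _; exact/Rle_lt_trans/d2_ge_fst.
Qed.

Lemma cont_on_snd2 (S : R * R -> Prop) : cont_on d2 d1 S snd.
Proof.
move=> x _ eps e0; exists eps; split=> // y _; exact/Rle_lt_trans/d2_ge_snd.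
Qed.

Lemma cont_on_fst3 (S : pt -> Prop) : cont_on d3 d1 S (fun x => fst (fst x)).
Proof.
move=> x _ eps e0; exists eps; split=> // y _; apply/Rle_lt_trans.
exact/(Rle_trans _ _ _ (d2_ge_fst _ _))/d3_ge_fst.
Qed.

Lemma cont_on_snd3 (S : pt -> Prop) : cont_on d3 d1 S (fun x => snd (fst x)).
Proof.
move=> x _ eps e0; exists eps; split=> // y _; apply/Rle_lt_trans.
exact/(Rle_trans _ _ _ (d2_ge_snd _ _))/d3_ge_fst.
Qed.

(** * Concatenation of paths *)

Definition glue (B : Type) (f g : R -> B) (t : R) : B :=
  if Rle_dec t (1 / 2) then f (2 * t) else g (2 * t - 1).

Lemma glueL (B : Type) (f g : R -> B) t : t <= 1 / 2 -> glue f g t = f (2 * t).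
Proof. by rewrite /glue; case: Rle_dec. Qed.

Lemma glueR (B : Type) (f g : R -> B) t : f 1 = g 0 -> 1 / 2 <= t ->
  glue f g t = g (2 * t - 1).
Proof.
rewrite /glue; case: Rle_dec => //= h fg h'.
have -> : t = 1 / 2 by lra.
by rewrite (_ : 2 * (1 / 2) = 1) ?fg; [congr g; lra | lra].
Qed.

Lemma glue_cont (B : Type) (dB : B -> B -> R) (f g : R -> B) : f 1 = g 0 ->
  cont_on d1 dB I01 f -> cont_on d1 dB I01 g -> cont_on d1 dB I01 (glue f g).
Proof.
move=> fg cf cg x [x0 x1] eps e0.
have dbl u v d : d1 u v < d / 2 -> d1 (2 * u) (2 * v) < d /\ d1 (2 * u - 1) (2 * v - 1) < d.
  by rewrite /d1; split_Rabs; lra.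
have F : x <= 1 / 2 -> exists del, 0 < del /\ forall y, I01 y -> y <= 1 / 2 ->
    d1 x y < del -> dB (glue f g x) (glue f g y) < eps.
  move=> xh; have [d [d0 H]] := cf (2 * x) ltac:(rewrite /I01; lra) eps e0.
  exists (d / 2); split; first lra.
  move=> y [y0 y1] yh /dbl [xy _]; rewrite !glueL //.
  by apply: H => //; rewrite /I01; lra.
have G : 1 / 2 <= x -> exists del, 0 < del /\ forall y, I01 y -> 1 / 2 <= y ->
    d1 x y < del -> dB (glue f g x) (glue f g y) < eps.
  move=> xh; have [d [d0 H]] := cg (2 * x - 1) ltac:(rewrite /I01; lra) eps e0.
  exists (d / 2); split; first lra.
  move=> y [y0 y1] yh /dbl [_ xy]; rewrite !glueR //.
  by apply: H => //; rewrite /I01; lra.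
have [xh|[xh|xh]] := Rtotal_order x (1 / 2).
- have [d [d0 H]] := F ltac:(lra).
  exists (Rmin d (1 / 2 - x)); split; first by apply: Rmin_pos; lra.
  move=> y Iy xy; have := Rmin_l d (1 / 2 - x); have := Rmin_r d (1 / 2 - x) => m1 m2.
  by apply: H => //; move: xy; rewrite /d1; split_Rabs; lra.
- have [d [d0 H]] := F ltac:(lra).
  have [d' [d0' H']] := G ltac:(lra).
  exists (Rmin d d'); split; first exact: Rmin_pos.
  move=> y Iy xy; have := Rmin_l d d'; have := Rmin_r d d' => m1 m2.
  have [yh|yh] := Rle_lt_dec y (1 / 2); first by apply: H => //; lra.
  by apply: H' => //; lra.
have [d [d0 H]] := G ltac:(lra).
exists (Rmin d (x - 1 / 2)); split; first by apply: Rmin_pos; lra.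
move=> y Iy xy; have := Rmin_l d (x - 1 / 2); have := Rmin_r d (x - 1 / 2) => m1 m2.
by apply: H => //; move: xy; rewrite /d1; split_Rabs; lra.
Qed.

Lemma same_region_trans (C : pt -> Prop) (x y z : pt) :
  same_region C x y -> same_region C y z -> same_region C x z.
Proof.
move=> [f [cf [Hf [f0 f1]]]] [g [cg [Hg [g0 g1]]]].
have fg : f 1 = g 0 by rewrite f1.
exists (glue f g); split; first exact: glue_cont.
split; last first.
  rewrite glueL ?glueR //; try lra.
  by split; [rewrite -f0; congr f; lra | rewrite -g1; congr g; lra].
move=> t [t0 t1]; have [h|h] := Rle_lt_dec t (1 / 2).
  by rewrite glueL //; apply: Hf; rewrite /I01; lra.
by rewrite glueR //; [apply: Hg; rewrite /I01; lra | lra].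
Qed.

(** * Hemispheres and chords *)

Definition sg (s : bool) : R := if s then 1 else -1.

Definition inD (q : R * R) : Prop := fst q ^ 2 + snd q ^ 2 <= 1.

(** Inverse of the vertical projection of a closed hemisphere onto the disc (see [hemiE]); on the
    bounding circle both lifts agree. *)
Definition lift (s : bool) (q : R * R) : pt :=
  (q, sg s * sqrt (1 - (fst q * fst q + snd q * snd q))).

Definition hemi (s : bool) (x : pt) : Prop := S2 x /\ 0 <= sg s * snd x.

Definition mid (u v : R * R) (t : R) : R * R :=
  ((1 - t) * fst u + t * fst v, (1 - t) * snd u + t * snd v).

Lemma sg_sqr s : sg s * sg s = 1.
Proof. by case: s => /=; lra. Qed.

Lemma sgN s : sg (~~ s) = - sg s.
Proof. by case: s => /=; lra. Qed.

Lemma lift_cont (A : Type) (dA : A -> A -> R) (S : A -> Prop) s (f : A -> R * R) :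
  cont_on dA d1 S (fun x => fst (f x)) -> cont_on dA d1 S (fun x => snd (f x)) ->
  (forall x, S x -> inD (f x)) -> cont_on dA d3 S (fun x => lift s (f x)).
Proof.
move=> c1 c2 fD; apply: cont_on_pair3.
  by apply: (cont_on_ext _ (cont_on_pair2 c1 c2)) => x _; case: (f x).
apply: cont_on_scale.
apply: (@cont_on_comp _ _ _ (fun x => fst (f x) * fst (f x) + snd (f x) * snd (f x))
          (fun y => sqrt (1 - y))); last by apply: cont_on_add; apply: cont_on_sqr.
move=> x /fD; rewrite /inD => h.
apply: (continuity_pt_comp (fun y => 1 - y) sqrt).
  by apply: derivable_continuous_pt; reg.
by apply: continuity_pt_sqrt; lra.
Qed.

Lemma hemi_lift s q : inD q -> hemi s (lift s q).
Proof.
case: q => x y; rewrite /inD /hemi /lift /S2 /= => h.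
have s0 : 0 <= 1 - (x * x + y * y) by lra.
have := sqrt_sqrt _ s0; have := sqrt_pos (1 - (x * x + y * y)); have := sg_sqr s.
move: (sqrt _) (sg s) => w e; nra.
Qed.

Lemma lift_snd s q : snd (lift s q) = sg s * sqrt (1 - (fst q * fst q + snd q * snd q)).
Proof. by []. Qed.

Lemma hemiE s x : hemi s x -> inD (fst x) /\ x = lift s (fst x).
Proof.
case: x => [[x y] z]; rewrite /hemi /inD /S2 /lift /= => -[h1 h2].
have ss := sg_sqr s.
split; first by have := pow2_ge_0 z; lra.
rewrite (_ : 1 - (x * x + y * y) = (sg s * z) ^ 2).
  rewrite sqrt_pow2 // -Rmult_assoc sg_sqr; congr (_, _); ring.
rewrite Rpow_mult_distr /= !Rmult_1_r ss; lra.
Qed.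

Lemma S2_hemi x : S2 x -> exists s, hemi s x.
Proof.
move=> h; have [z0|z0] := Rle_lt_dec 0 (snd x); [exists true|exists false]; split=> //=; lra.
Qed.

Lemma mid_inD u v t : I01 t -> inD u -> inD v -> inD (mid u v t).
Proof.
case: u v => a b [c d]; rewrite /inD /I01 /mid /= => -[t0 t1] h1 h2.
(* This is the convexity defect of the squared norm: the average of the two squared norms minus the
   squared norm of the average. *)
have k : 0 <= (1 - t) * t * ((a - c) ^ 2 + (b - d) ^ 2).
  apply: Rmult_le_pos; first nra.
  by have := pow2_ge_0 (a - c); have := pow2_ge_0 (b - d); lra.
have m1 : (1 - t) * (a ^ 2 + b ^ 2) <= 1 - t by nra.
have m2 : t * (c ^ 2 + d ^ 2) <= t by nra.
lra.
Qed.

Definition aff (g : R * R -> R) : Prop :=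
  forall u v t, g (mid u v t) = (1 - t) * g u + t * g v.

Lemma aff_opp g : aff g -> aff (fun q => - g q).
Proof. by move=> h u v t; rewrite h; ring. Qed.

Lemma aff_scale c g : aff g -> aff (fun q => c * g q).
Proof. by move=> h u v t; rewrite h; ring. Qed.

Lemma aff_const c : aff (fun=> c).
Proof. by move=> u v t; ring. Qed.

Lemma mid_sym u v t : mid u v (1 - t) = mid v u t.
Proof. by rewrite /mid; congr (_, _); ring. Qed.

Lemma mid0 u v : mid u v 0 = u.
Proof. by case: u => a b; rewrite /mid /=; congr (_, _); ring. Qed.

Lemma mid1 u v : mid u v 1 = v.
Proof. by case: v => a b; rewrite /mid /=; congr (_, _); ring. Qed.

Lemma mid_cont s u v : inD u -> inD v -> cont_on d1 d3 I01 (fun t => lift s (mid u v t)).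
Proof.
move=> hu hv.
have line a b : cont_on d1 d1 I01 (fun t => (1 - t) * a + t * b).
  apply: (cont_on_ext (f := fun t => a + (b - a) * t)); first by move=> t _; ring.
  by apply: cont_on_add; [exact: cont_on_const | exact/cont_on_scale/cont_on_id].
by apply: lift_cont => /=; [exact: line | exact: line | move=> t It; exact: mid_inD].
Qed.

(* The rational parametrization of the unit circle, at integer parameters. *)
Definition P (k : nat) : R * R :=
  ((1 - INR k * INR k) / (1 + INR k * INR k), 2 * INR k / (1 + INR k * INR k)).

Definition cp (k : nat) : pt := (P k, 0).

(* An affine function vanishing on the line through [P a] and [P b]: see [L_P]. *)
Definition L (a b : nat) (q : R * R) : R :=
  (1 + INR a * INR b) - (1 - INR a * INR b) * fst q - (INR a + INR b) * snd q.

Definition seg (a b : nat) (t : R) : R * R := mid (P a) (P b) t.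

Lemma den_pos x : 0 < 1 + x * x. Proof. nra. Qed.
Lemma den_neq0 x : 1 + x * x <> 0. Proof. nra. Qed.

(** Up to a positive factor the value is a product of two differences of indices; this turns the
    geometry of chords into comparisons of natural numbers. *)
Lemma L_P a b t :
  L a b (P t) = 2 * ((INR t - INR a) * (INR t - INR b)) / (1 + INR t * INR t).
Proof. rewrite /L /P /=; field; exact: den_neq0. Qed.

Lemma L_aff a b : aff (L a b).
Proof. by move=> u v t; rewrite /L /mid /=; ring. Qed.

Definition between (a b t : nat) : Prop := (a < t /\ t < b \/ b < t /\ t < a)%N.
Definition outside (a b t : nat) : Prop := (t < a /\ t < b \/ a < t /\ b < t)%N.

Lemma ltINR a b : (a < b)%N -> INR a < INR b.
Proof. by move=> h; apply: lt_INR; lia. Qed.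

Lemma L_neg a b t : between a b t -> L a b (P t) < 0.
Proof.
move=> h; rewrite L_P; have d := Rinv_0_lt_compat _ (den_pos (INR t)).
have k : (INR t - INR a) * (INR t - INR b) < 0.
  by case: h => -[/ltINR ? /ltINR ?]; nra.
rewrite /Rdiv; nra.
Qed.

Lemma L_pos a b t : outside a b t -> 0 < L a b (P t).
Proof.
move=> h; rewrite L_P; have d := Rinv_0_lt_compat _ (den_pos (INR t)).
have k : 0 < (INR t - INR a) * (INR t - INR b).
  by case: h => -[/ltINR ? /ltINR ?]; nra.
rewrite /Rdiv; nra.
Qed.

Lemma L_l a b : L a b (P a) = 0.
Proof. rewrite L_P; field; exact: den_neq0. Qed.

Lemma L_r a b : L a b (P b) = 0.
Proof. rewrite L_P; field; exact: den_neq0. Qed.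

Lemma L_seg a b t : L a b (seg a b t) = 0.
Proof. by rewrite /seg L_aff L_l L_r; ring. Qed.

Lemma L_eq0 a b t : L a b (P t) = 0 -> t = a \/ t = b.
Proof.
move=> h; have [ta|ta] := eqVneq t a; first by left.
have [tb|tb] := eqVneq t b; first by right.
have [/L_neg|/L_pos] : between a b t \/ outside a b t by rewrite /between /outside; lia.
all: lra.
Qed.

Lemma P_inj a b : P a = P b -> a = b.
Proof.
by move=> h; have := L_l a a; rewrite h => /L_eq0; lia.
Qed.

Lemma P_norm k : fst (P k) * fst (P k) + snd (P k) * snd (P k) = 1.
Proof. rewrite /P /=; field; exact: den_neq0. Qed.

Lemma P_inD k : inD (P k).
Proof. rewrite /inD; have := P_norm k; lra. Qed.

Lemma seg_inD a b t : I01 t -> inD (seg a b t).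
Proof. by move=> It; apply: mid_inD => //; exact: P_inD. Qed.

Lemma lift_P s k : lift s (P k) = cp k.
Proof. by rewrite /lift P_norm Rminus_diag sqrt_0 Rmult_0_r. Qed.

Lemma hemi_cp s k : hemi s (cp k).
Proof. by rewrite -(lift_P s); exact/hemi_lift/P_inD. Qed.

Lemma cp_inj a b : cp a = cp b -> a = b.
Proof. by case=> h1 h2; apply: P_inj; rewrite /P h1 h2. Qed.

(** The power of a point with respect to the circle; [K] is the squared length of the chord. Its
    sign tells both that a chord is interior strictly between its ends and that its line leaves the
    disc beyond them. *)
Lemma seg_norm a b : a <> b -> exists2 K, 0 < K & forall t,
  1 - (fst (seg a b t) * fst (seg a b t) + snd (seg a b t) * snd (seg a b t))
  = K * (t * (1 - t)).
Proof.
move=> ab.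
exists (4 * ((INR a - INR b) * (INR a - INR b)) / ((1 + INR a * INR a) * (1 + INR b * INR b))).
  apply: Rdiv_lt_0_compat; last by apply: Rmult_lt_0_compat; exact: den_pos.
  by have := not_INR _ _ ab; nra.
move=> t; rewrite /seg /mid /P /=; field; split; exact: den_neq0.
Qed.

Lemma line_disc a b q : a <> b -> inD q -> L a b q = 0 ->
  exists2 t, I01 t & q = seg a b t.
Proof.
move=> ab qD Lq.
have [K K0 HK] := seg_norm ab.
have ab' : INR b - INR a <> 0 by have := not_INR _ _ ab; lra.
have [t qt] : exists t, q = seg a b t.
  (* The line has direction [(-(a + b), 1 - a * b)], whose squared norm [(1 + a * a) * (1 + b * b)]
     is the denominator in [P b - P a]. The witness is the inner product of [q - P a] with this
     direction, divided by that of [P b - P a], which is [2 * (b - a)]. *)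
  exists (((1 - INR a * INR b) * (snd q - snd (P a)) - (INR a + INR b) * (fst q - fst (P a)))
          / (2 * (INR b - INR a))).
  have h1 : (INR a + INR b) * (snd q - snd (P a)) = - ((1 - INR a * INR b) * (fst q - fst (P a))).
    by have := L_l a b; move: Lq; rewrite /L; lra.
  have da := @den_neq0 (INR a); have db := @den_neq0 (INR b).
  have dx : fst (P b) - fst (P a) =
      - (2 * (INR b - INR a) * (INR a + INR b)) / ((1 + INR a * INR a) * (1 + INR b * INR b)).
    by rewrite /P /=; field; split.
  have dy : snd (P b) - snd (P a) =
      2 * (INR b - INR a) * (1 - INR a * INR b) / ((1 + INR a * INR a) * (1 + INR b * INR b)).
    by rewrite /P /=; field; split.
  set t := _ / _.
  have -> : q = (fst q, snd q) by case: (q).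
  rewrite /seg /mid; congr (_, _).
    rewrite (_ : (1 - t) * _ + _ = fst (P a) + t * (fst (P b) - fst (P a))); last ring.
    rewrite dx /t.
    apply: (Rplus_eq_reg_r (- fst (P a))).
    apply: (Rmult_eq_reg_r ((1 + INR a * INR a) * (1 + INR b * INR b)));
    last by apply: Rmult_integral_contrapositive_currified.
    transitivity (- (INR a + INR b) * ((1 - INR a * INR b) * (snd q - snd (P a)) -
      (INR a + INR b) * (fst q - fst (P a)))); last by field; split; [|split].
    have := congr1 (Rmult (1 - INR a * INR b)) h1; lra.
  rewrite (_ : (1 - t) * _ + _ = snd (P a) + t * (snd (P b) - snd (P a))); last ring.
  rewrite dy /t.
  apply: (Rplus_eq_reg_r (- snd (P a))).
  apply: (Rmult_eq_reg_r ((1 + INR a * INR a) * (1 + INR b * INR b)));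
    last by apply: Rmult_integral_contrapositive_currified.
  transitivity ((1 - INR a * INR b) * ((1 - INR a * INR b) * (snd q - snd (P a)) -
      (INR a + INR b) * (fst q - fst (P a)))); last by field; split; [|split].
  have := congr1 (Rmult (INR a + INR b)) h1; lra.
exists t => //; have := HK t; rewrite -qt => e.
have k : 0 <= K * (t * (1 - t)) by move: qD; rewrite /inD; lra.
have k' : 0 <= t * (1 - t) by apply: (Rmult_le_reg_l K) => //; lra.
by rewrite /I01; nra.
Qed.

(** [L a a] is the tangent at [P a] and vanishes at no other [P b], so its value is a coordinate
    along the chord. *)
Lemma seg_inj a b s t : a <> b -> seg a b s = seg a b t -> s = t.
Proof.
move=> ab h; have /= := L_aff a a (P a) (P b) s; have /= := L_aff a a (P a) (P b) t.
rewrite -!/(seg a b _) -h L_l => -> e.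
have [z|nz] := Req_dec (L a a (P b)) 0; last by nra.
by case: (L_eq0 z) => // /esym.
Qed.

(** An affine function with two zeros on a segment vanishes at both ends, and among the points [P k]
    only [P c] and [P d] are zeros of [L c d]. *)
Lemma two_common a b c d s t : a <> b -> s <> t ->
  L c d (seg a b s) = 0 -> L c d (seg a b t) = 0 ->
  (a = c \/ a = d) /\ (b = c \/ b = d).
Proof.
rewrite /seg !L_aff => ab st h1 h2.
have e : (s - t) * (L c d (P b) - L c d (P a)) = 0 by lra.
have [|e'] := Rmult_integral _ _ e; first lra.
have e1 : L c d (P b) = L c d (P a) by lra.
by split; apply: L_eq0; move: h1; rewrite e1; lra.
Qed.

Definition interlaced (a b c d : nat) : Prop :=
  between a b c /\ outside a b d \/ outside a b c /\ between a b d.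

(** An affine function with a zero strictly inside a segment has opposite signs at the ends or
    vanishes at both; the second case is the excluded coincidence of the chords. *)
Lemma chords_cross a b c d s : 0 < s < 1 -> a <> b ->
  ~ ((a = c \/ a = d) /\ (b = c \/ b = d)) ->
  L c d (seg a b s) = 0 -> interlaced a b c d.
Proof.
rewrite /seg L_aff => s01 ab ne h.
have pos t : [\/ between c d t /\ L c d (P t) < 0, outside c d t /\ 0 < L c d (P t)
              | (t = c \/ t = d) /\ L c d (P t) = 0].
  have [e|ne'] := classic (t = c \/ t = d).
    by apply: Or33; split=> //; case: e => ->; [exact: L_l | exact: L_r].
  have [k|k] : between c d t \/ outside c d t by rewrite /between /outside; lia.
    by apply: Or31; split=> //; exact: L_neg.
  by apply: Or32; split=> //; exact: L_pos.
case: (pos a) => -[ha la]; case: (pos b) => -[hb lb]; try (exfalso; nra).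
- by move: ha hb; rewrite /interlaced /between /outside; lia.
- by move: ha hb; rewrite /interlaced /between /outside; lia.
- by case: ne.
Qed.

(** * Crossings *)

Lemma cont_on_L c a b (S : pt -> Prop) : cont_on d3 d1 S (fun y => c * L a b (fst y)).
Proof.
apply: cont_on_scale.
apply: (cont_on_ext (f := fun y : pt => (1 + INR a * INR b) +
  (- (1 - INR a * INR b) * fst (fst y) + - (INR a + INR b) * snd (fst y)))).
  by move=> y _; rewrite /L; ring.
apply: cont_on_add; first exact: cont_on_const.
apply: cont_on_add; apply: cont_on_scale; [exact: cont_on_fst3 | exact: cont_on_snd3].
Qed.

Lemma cont_on_z (S : pt -> Prop) : cont_on d3 d1 S snd.
Proof.
move=> [[a b] c] _ eps e0; exists eps; split=> // -[[a' b'] c'] _.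
apply/Rle_lt_trans; rewrite /d1 /d3 -sqrt_Rsqr_abs; apply: sqrt_le_1_alt.
by rewrite /Rsqr /=; have := pow2_ge_0 (a - a'); have := pow2_ge_0 (b - b'); lra.
Qed.

Lemma cont_on_pos (f : pt -> R) x : cont_on d3 d1 (fun=> True) f -> 0 < f x ->
  exists eps, 0 < eps /\ forall y, d3 x y < eps -> 0 < f y.
Proof.
move=> cf fx; have [d [d0 H]] := cf x I _ fx.
by exists d; split=> // y /(H y I); rewrite /d1; split_Rabs; lra.
Qed.

(** The determinant of the linear parts of the two functions. If it were zero, [L c d] would be
    constant along the chord from [a] to [b], hence zero there because of the common point [q]. *)
Lemma chords_indep a b c d q : a <> b ->
  ~ ((a = c \/ a = d) /\ (b = c \/ b = d)) -> inD q -> L a b q = 0 -> L c d q = 0 ->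
  (1 - INR a * INR b) * (INR c + INR d) - (1 - INR c * INR d) * (INR a + INR b) <> 0.
Proof.
move=> ab ne qD /(line_disc ab qD) [t _ ->]; rewrite /seg L_aff => h D.
have e : L c d (P b) = L c d (P a).
  transitivity (L c d (P a) - 2 * (INR b - INR a) * ((1 - INR a * INR b) * (INR c + INR d) -
      (1 - INR c * INR d) * (INR a + INR b)) / ((1 + INR a * INR a) * (1 + INR b * INR b))).
    by rewrite /L /P /=; field; split; exact: den_neq0.
  by rewrite D; field; split; exact: den_neq0.
have e0 : L c d (P a) = 0 by move: h; rewrite e; lra.
by apply: ne; split; apply: L_eq0; rewrite ?e.
Qed.

(** Tells how much the coordinate chart at a crossing has to be shrunk to stay inside the open
    disc. *)
Lemma small_disc x y w1 w2 W eta : 0 < eta <= 1 -> w1 * w1 + w2 * w2 <= W ->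
  x * x + y * y < 1 -> eta * (1 + 2 * W) <= 1 - (x * x + y * y) ->
  (x + eta * w1) * (x + eta * w1) + (y + eta * w2) * (y + eta * w2) < 1.
Proof.
move=> [e0 e1] hw hq he.
have h1 : 2 * (x * w1 + y * w2) <= x * x + y * y + (w1 * w1 + w2 * w2).
  by have := pow2_ge_0 (x - w1); have := pow2_ge_0 (y - w2); lra.
have h2 : eta * (2 * (x * w1 + y * w2)) <= eta * (x * x + y * y + W).
  by apply: Rmult_le_compat_l; lra.
have h3 : eta * (x * x + y * y) < eta * 1 by apply: Rmult_lt_compat_l.
have h4 : eta * eta * (w1 * w1 + w2 * w2) <= eta * 1 * W.
  have w0 : 0 <= w1 * w1 + w2 * w2 by nra.
  by apply: Rmult_le_compat => //; [nra | apply: Rmult_le_compat_l; lra].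
lra.
Qed.

(** The functions [L c d] and [L a b], suitably scaled, are themselves the coordinates of the chart:
    their zero sets are the two arcs, and their linear parts are independent. *)
Lemma chords_proper_crossing (g1 g2 : R -> pt) x s a b c d : a <> b ->
  ~ ((a = c \/ a = d) /\ (b = c \/ b = d)) ->
  S2 x -> 0 < sg s * snd x -> on_arc g1 x -> on_arc g2 x ->
  (forall y, S2 y -> 0 < sg s * snd y -> (on_arc g1 y <-> L a b (fst y) = 0)) ->
  (forall y, S2 y -> 0 < sg s * snd y -> (on_arc g2 y <-> L c d (fst y) = 0)) ->
  proper_crossing g1 g2 x.
Proof.
move=> ab ne xS xs x1 x2 H1 H2.
have Lx1 := (H1 x xS xs).1 x1; have Lx2 := (H2 x xS xs).1 x2.
have [qD xE] : inD (fst x) /\ x = lift s (fst x) by apply: hemiE; split=> //; lra.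
have Dl := chords_indep ab ne qD Lx1 Lx2.
have q1 : fst (fst x) * fst (fst x) + snd (fst x) * snd (fst x) < 1.
  have : 0 < snd x * snd x by case: (s) xs => /=; nra.
  by move: xS; case: (x) => [[u v] w]; rewrite /S2 /=; lra.
set q := fst x in Lx1 Lx2 qD q1 xE.
set A1 := 1 - INR a * INR b in Dl; set B1 := INR a + INR b in Dl.
set A2 := 1 - INR c * INR d in Dl; set B2 := INR c + INR d in Dl.
have LabE p : L a b p = - A1 * (fst p - fst q) - B1 * (snd p - snd q).
  by rewrite -(Rminus_0_r (L a b p)) -Lx1 /L /A1 /B1; ring.
have LcdE p : L c d p = - A2 * (fst p - fst q) - B2 * (snd p - snd q).
  by rewrite -(Rminus_0_r (L c d p)) -Lx2 /L /A2 /B2; ring.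
set D := A1 * B2 - A2 * B1 in Dl.
set W := A1 * A1 + A2 * A2 + B1 * B1 + B2 * B2.
have W0 : 0 <= W by rewrite /W; nra.
set r := 1 - (fst q * fst q + snd q * snd q).
have r0 : 0 < r by rewrite /r; lra.
have r1 : r <= 1 by rewrite /r; nra.
(* By Cauchy-Schwarz [W] bounds the squared norm of the displacement [(kp z - q) / eta] for [z] in
   the unit disc, and [r] is the room left around [q], so [small_disc] applies. *)
set eta := r / (1 + 2 * W).
have eE : eta * (1 + 2 * W) = r by rewrite /eta; field; lra.
have e0 : 0 < eta by apply: Rdiv_lt_0_compat; lra.
have e1 : eta <= 1 by nra.
(* Inverse of the chart by Cramer's rule: on [kp (u, v)] the functions [L c d] and [L a b] take the
   values [eta * D * u] and [eta * D * v]. *)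
set kp := fun z : R * R => (fst q + eta * (B1 * fst z - B2 * snd z),
                            snd q + eta * (A2 * snd z - A1 * fst z)).
set c0 := / (eta * D).
set h := fun y : pt => (c0 * L c d (fst y), c0 * L a b (fst y)).
have eD : eta * D <> 0 by apply: Rmult_integral_contrapositive_currified; lra.
have eta0 : eta <> 0 by lra.
have kpD z : disk2 z -> fst (kp z) * fst (kp z) + snd (kp z) * snd (kp z) < 1.
  case: z => u v; rewrite /disk2 /= => uv; apply: (@small_disc _ _ _ _ W) => //.
    rewrite /W.
    have : (B1 * u - B2 * v) * (B1 * u - B2 * v) <= (B1 * B1 + B2 * B2) * (u * u + v * v).
      by have := pow2_ge_0 (B1 * v + B2 * u); lra.
    have : (A2 * v - A1 * u) * (A2 * v - A1 * u) <= (A1 * A1 + A2 * A2) * (u * u + v * v).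
      by have := pow2_ge_0 (A1 * v + A2 * u); lra.
    have : (B1 * B1 + B2 * B2) * (u * u + v * v) <= (B1 * B1 + B2 * B2) * 1.
      by apply: Rmult_le_compat_l; nra.
    have : (A1 * A1 + A2 * A2) * (u * u + v * v) <= (A1 * A1 + A2 * A2) * 1.
      by apply: Rmult_le_compat_l; nra.
    lra.
  by rewrite eE /r; lra.
have kpI z : disk2 z -> inD (kp z) by move/kpD; rewrite /inD; lra.
have hk z : h (lift s (kp z)) = z.
  rewrite /h LabE LcdE /= /c0 /D.
  case: z => u v /=; congr (_, _); field; split => //.
exists (fun y => S2 y /\ 0 < sg s * snd y /\ disk2 (h y)), h, (fun z => lift s (kp z)).
have hx : h x = (0, 0) by rewrite /h Lx1 Lx2; congr (_, _); ring.
have ch S : cont_on d3 d2 S h by apply: cont_on_pair2; exact: cont_on_L.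
split; last split; last split; last split; last split; last split; last split; last split.
- split; first by move=> y [].
  move=> y [yS [ys yh]].
  have [e [ep He]] := cont_on_pos (cont_on_scale (sg s) (@cont_on_z _)) ys.
  have [||e' [ep' He']] := @cont_on_pos (fun y => 1 + (-1) * (fst (h y) * fst (h y) + snd (h y) * snd (h y))) y.
  + apply: cont_on_add; first exact: cont_on_const.
    apply/cont_on_scale/cont_on_add; apply: cont_on_sqr; exact: cont_on_L.
  + by move: yh; rewrite /disk2; lra.
  exists (Rmin e e'); split; first exact: Rmin_pos.
  move=> y' y'S yy'; split=> //; split.
    exact/He/(Rlt_le_trans _ _ _ yy')/Rmin_l.
  have /He' := Rlt_le_trans _ _ _ yy' (Rmin_r e e').
  by rewrite /disk2; lra.
- by split=> //; split=> //; rewrite hx /disk2 /=; lra.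
- exact: ch.
- apply: lift_cont => /=; last by move=> z /kpI.
    apply: cont_on_add; first exact: cont_on_const.
    apply/cont_on_scale.
    apply: (cont_on_ext (f := fun z : R * R => B1 * fst z + - B2 * snd z)); first by move=> z _; ring.
    by apply: cont_on_add; apply: cont_on_scale; [exact: cont_on_fst2 | exact: cont_on_snd2].
  apply: cont_on_add; first exact: cont_on_const.
  apply/cont_on_scale.
  apply: (cont_on_ext (f := fun z : R * R => - A1 * fst z + A2 * snd z)); first by move=> z _; ring.
  by apply: cont_on_add; apply: cont_on_scale; [exact: cont_on_fst2 | exact: cont_on_snd2].
- move=> y [yS [ys yh]]; split=> //.
  have [yD yE] : inD (fst y) /\ y = lift s (fst y) by apply: hemiE; split=> //; lra.
  rewrite [in RHS]yE; congr lift.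
  rewrite /kp /h /= LabE LcdE /c0.
  case: (fst y) => u v /=; congr (_, _); rewrite /D; field; split=> //.
- move=> z zd; rewrite hk; split=> //.
  have [hS _] := hemi_lift s (kpI _ zd).
  split=> //; split=> //.
  rewrite lift_snd -Rmult_assoc sg_sqr Rmult_1_l; apply: sqrt_lt_R0.
  by have := kpD _ zd; lra.
- exact: hx.
- move=> y [yS [ys _]]; rewrite (H1 y yS ys) /h /=; split=> [->|e]; first by rewrite Rmult_0_r.
  by have [|//] := Rmult_integral _ _ e; have := Rinv_neq_0_compat _ eD; rewrite /c0.
- move=> y [yS [ys _]]; rewrite (H2 y yS ys) /h /=; split=> [->|e]; first by rewrite Rmult_0_r.
  by have [|//] := Rmult_integral _ _ e; have := Rinv_neq_0_compat _ eD; rewrite /c0.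
Qed.

(** * Arcs *)

Definition segarc (s : bool) (a b : nat) (t : R) : pt := lift s (seg a b t).

Definition zz (s : bool) (a m b : nat) : R -> pt := glue (segarc s a m) (segarc (~~ s) m b).

Lemma segarc0 s a b : segarc s a b 0 = cp a.
Proof. by rewrite /segarc /seg mid0 lift_P. Qed.

Lemma segarc1 s a b : segarc s a b 1 = cp b.
Proof. by rewrite /segarc /seg mid1 lift_P. Qed.

Lemma segarc_hemi s a b t : I01 t -> hemi s (segarc s a b t).
Proof. by move=> It; exact/hemi_lift/seg_inD. Qed.

Lemma segarc_rev s a b t : segarc s a b (1 - t) = segarc s b a t.
Proof. by rewrite /segarc /seg mid_sym. Qed.

Lemma segarc_inj s s' a b t t' : a <> b -> segarc s a b t = segarc s' a b t' -> t = t'.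
Proof. by move=> ab /(congr1 fst) /= /(seg_inj ab). Qed.

Lemma segarc_strict s a b t : a <> b -> 0 < t < 1 -> 0 < sg s * snd (segarc s a b t).
Proof.
move=> ab t01; have [K K0 HK] := seg_norm ab.
rewrite /segarc lift_snd -Rmult_assoc sg_sqr Rmult_1_l HK; apply: sqrt_lt_R0.
by apply: Rmult_lt_0_compat => //; nra.
Qed.

Lemma segarc_z0 s a b t : a <> b -> I01 t -> snd (segarc s a b t) = 0 -> t = 0 \/ t = 1.
Proof.
move=> ab [t0 t1] z; have [e|n0] := Req_dec t 0; first by left.
have [e|n1] := Req_dec t 1; first by right.
by have := @segarc_strict s a b t ab ltac:(lra); rewrite z; lra.
Qed.

Lemma segarc_cont s a b : cont_on d1 d3 I01 (segarc s a b).
Proof. by apply: mid_cont; exact: P_inD. Qed.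

Lemma on_segarc s a b y : a <> b -> hemi s y ->
  (on_arc (segarc s a b) y <-> L a b (fst y) = 0).
Proof.
move=> ab /hemiE [yD yE]; split=> [[t [It <-]]|h]; first by rewrite /segarc /= L_seg.
by have [t It qt] := line_disc ab yD h; exists t; split=> //; rewrite /segarc -qt.
Qed.

Lemma segarc_jordan s a b : a <> b -> jordan_arc (segarc s a b) (cp a) (cp b).
Proof.
move=> ab; split; first exact: segarc_cont.
split; first by move=> t t' _ _; exact: segarc_inj.
by split; [move=> t /(segarc_hemi s a b) [] | rewrite segarc0 segarc1].
Qed.

Lemma zzL s a m b t : t <= 1 / 2 -> zz s a m b t = segarc s a m (2 * t).
Proof. exact: glueL. Qed.

Lemma zzR s a m b t : 1 / 2 <= t -> zz s a m b t = segarc (~~ s) m b (2 * t - 1).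
Proof. by apply: glueR; rewrite segarc0 segarc1. Qed.

Lemma zz0 s a m b : zz s a m b 0 = cp a.
Proof. by rewrite zzL ?Rmult_0_r ?segarc0 //; lra. Qed.

Lemma zz1 s a m b : zz s a m b 1 = cp b.
Proof. by rewrite zzR; [rewrite (_ : 2 * 1 - 1 = 1) ?segarc1 //; ring | lra]. Qed.

Lemma zz_half s a m b : zz s a m b (1 / 2) = cp m.
Proof. by rewrite zzL; [rewrite (_ : 2 * (1 / 2) = 1) ?segarc1 //; field | lra]. Qed.

(** Reversal exchanges the hemispheres, so whatever is proved about first halves also serves for
    last halves. *)
Lemma zz_rev s a m b t : zz s a m b (1 - t) = zz (~~ s) b m a t.
Proof.
have [h|h] := Rle_lt_dec t (1 / 2).
  rewrite zzR; last lra.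
  by rewrite zzL // -segarc_rev; congr segarc; ring.
rewrite zzL; last lra.
by rewrite zzR ?negbK; [rewrite -segarc_rev; congr segarc; ring | lra].
Qed.

Lemma zz_S2 s a m b t : I01 t -> S2 (zz s a m b t).
Proof.
move=> [t0 t1]; have [h|h] := Rle_lt_dec t (1 / 2).
  by rewrite zzL //; apply: (segarc_hemi s a m _).1; rewrite /I01; lra.
by rewrite zzR; [apply: (segarc_hemi (~~ s) m b _).1; rewrite /I01 | ]; lra.
Qed.

Lemma zz_strictL s a m b t : a <> m -> 0 < t < 1 / 2 -> 0 < sg s * snd (zz s a m b t).
Proof. by move=> am t01; rewrite zzL; [apply: segarc_strict => // | ]; lra. Qed.

Lemma zz_strictR s a m b t : m <> b -> 1 / 2 < t < 1 -> sg s * snd (zz s a m b t) < 0.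
Proof.
move=> mb t01; rewrite zzR; last lra.
by have := @segarc_strict (~~ s) m b (2 * t - 1) mb ltac:(lra); rewrite sgN; lra.
Qed.

Lemma zz_case t : I01 t -> t = 0 \/ 0 < t < 1 / 2 \/ t = 1 / 2 \/ 1 / 2 < t < 1 \/ t = 1.
Proof. rewrite /I01; lra. Qed.

(** Within one half this is injectivity on a chord. Parameters in different halves give heights of
    opposite signs, except at the ends, which [a <> b] keeps apart. *)
Lemma zz_inj s a m b t t' : a <> m -> m <> b -> a <> b -> I01 t -> I01 t' ->
  zz s a m b t = zz s a m b t' -> t = t'.
Proof.
move=> am mb ab.
wlog tt : t t' / t <= t'.
  by move=> W It It' e; have [h|h] := Rle_lt_dec t t'; [exact: W | symmetry; apply: W => //; lra].
move=> It It' e.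
have [h'|h'] := Rle_lt_dec t' (1 / 2).
  by move: e; rewrite !zzL; [move/(segarc_inj am) => ? | | ]; lra.
have [h|h] := Rle_lt_dec (1 / 2) t.
  by move: e; rewrite !zzR; [move/(segarc_inj mb) => ? | | ]; lra.
have c k : zz s a m b t = cp k -> k = a.
  case: It => t0 _; have [t00|t0'] : t = 0 \/ 0 < t by lra.
    by rewrite t00 zz0 => /cp_inj.
  by move=> ek; have := @zz_strictL s a m b t am ltac:(lra); rewrite ek /=; lra.
case: It' => _ t1; have [t11|t1'] : t' = 1 \/ t' < 1 by lra.
  by move: e; rewrite t11 zz1 => /c /esym.
have n1 := @zz_strictR s a m b t' mb ltac:(lra).
have p0 : 0 <= sg s * snd (zz s a m b t).
  rewrite zzL; last lra.
  by apply: (segarc_hemi s a m _).2; move: It; rewrite /I01; lra.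
by move: p0; rewrite e; lra.
Qed.

Lemma zz_jordan s a m b : a <> m -> m <> b -> a <> b -> jordan_arc (zz s a m b) (cp a) (cp b).
Proof.
move=> am mb ab; split.
  by apply: glue_cont; [rewrite segarc0 segarc1 | exact: segarc_cont | exact: segarc_cont].
split; first by move=> t t'; exact: zz_inj.
by split; [exact: zz_S2 | rewrite zz0 zz1].
Qed.

Lemma segarc_opp s a b y : S2 y -> 0 < sg s * snd y -> ~ on_arc (segarc (~~ s) a b) y.
Proof.
move=> yS ys [t [/(segarc_hemi (~~ s) a b) [_ h] e]]; move: h; rewrite e sgN; lra.
Qed.

Lemma on_zz s a m b y : on_arc (zz s a m b) y <->
  on_arc (segarc s a m) y \/ on_arc (segarc (~~ s) m b) y.
Proof.
split=> [[t [[t0 t1] <-]]|[] [t [[t0 t1] <-]]].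
- have [h|h] := Rle_lt_dec t (1 / 2).
    by left; exists (2 * t); rewrite zzL // /I01; split=> //; lra.
  by right; exists (2 * t - 1); rewrite zzR /I01; [split=> //; lra | lra].
- exists (t / 2); rewrite zzL; last lra.
  by split; [rewrite /I01; lra | congr segarc; field].
- exists ((t + 1) / 2); rewrite zzR; last lra.
  by split; [rewrite /I01; lra | congr segarc; field].
Qed.

Lemma on_zz_strict s a m b y : m <> a -> m <> b -> S2 y ->
  (0 < sg s * snd y -> (on_arc (zz s a m b) y <-> L a m (fst y) = 0)) /\
  (0 < sg (~~ s) * snd y -> (on_arc (zz s a m b) y <-> L m b (fst y) = 0)).
Proof.
move=> ma mb yS; split=> ys; rewrite on_zz.
  rewrite -(@on_segarc s a m); [|exact/nesym|by split=> //; lra].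
  by split=> [[//|/(segarc_opp yS ys)]|]; [|left].
rewrite -(@on_segarc (~~ s) m b) //; last by split=> //; lra.
have ys' : ~ on_arc (segarc s a m) y by rewrite -(negbK s); exact: segarc_opp.
by split=> [[/ys'|//]|]; [|right].
Qed.

(** * The edges *)

(* Vertex [v] sits at parameter [2 v]; [inl (s, (a, b))] is the chord [ab] in the
   hemisphere [s], and [inr i] the edge from [i] to [i + 3] that leaves the northern
   hemisphere halfway between [i + 1] and [i + 2]. *)
Definition desc : Type := ((bool * (nat * nat)) + nat)%type.

(** Reduction modulo [2 * n] for arguments below [4 * n]. As a conditional it can be split, after
    which [lia] settles every comparison. *)
Definition wrap (n x : nat) : nat := if (x < 2 * n)%N then x else (x - 2 * n)%N.

Definition arcd (n : nat) (d : desc) : R -> pt :=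
  match d with
  | inl (s, (a, b)) => segarc s (2 * a) (2 * b)
  | inr i => zz true (2 * i) (wrap n (2 * i + 3)) (wrap n (2 * i + 6))
  end.

Definition dends (n : nat) (d : desc) : nat * nat :=
  match d with inl (_, (a, b)) => (a, b) | inr i => (i, (i + 3) %% n) end.

(** The clause [a <= 1 \/ b <= a + 2] is all that is kept of the Capoyleas-Pach construction; the
    clause for [s = false] forbids sides in the southern hemisphere. *)
Definition wf_desc (n : nat) (d : desc) : Prop :=
  match d with
  | inl (s, (a, b)) => [/\ (a < b)%N, (b < n)%N, (a <= 1 \/ b <= a + 2)%N
      & s = false -> (a + 1 < b)%N /\ ~ (a = 0%N /\ b = (n - 1)%N)]
  | inr i => (i < n)%N
  end.

(** The chord of the edge in the hemisphere [s], given by its ends among the [2 * n] points. It is a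
    relation because a straight edge has no chord in the other hemisphere. *)
Definition part (n : nat) (d : desc) (s : bool) (a b : nat) : Prop :=
  match d with
  | inl (s', (a', b')) => [/\ s' = s, a = (2 * a')%N & b = (2 * b')%N]
  | inr i => if s then a = (2 * i)%N /\ b = wrap n (2 * i + 3)
             else a = wrap n (2 * i + 3) /\ b = wrap n (2 * i + 6)
  end.

Ltac wr := rewrite /wrap; repeat case: ifP; try lia.

Section Edges.
Variable n : nat.
Hypothesis n4 : (4 <= n)%N.

Lemma zig_neq i : (i < n)%N ->
  [/\ (2 * i)%N <> wrap n (2 * i + 3), wrap n (2 * i + 3) <> wrap n (2 * i + 6)
    & (2 * i)%N <> wrap n (2 * i + 6)].
Proof. by move=> ni; split; wr. Qed.

Lemma part_neq d s a b : wf_desc n d -> part n d s a b -> a <> b.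
Proof.
case: d => [[s' [a' b']]|i] /=; first by case=> h _ _ _ [_ -> ->]; lia.
by case/zig_neq => h1 h2 _; case: s => -[-> ->].
Qed.

Lemma part_uniq d s a b a' b' : part n d s a b -> part n d s a' b' -> a = a' /\ b = b'.
Proof.
case: d => [[s' [x y]]|i] /=; first by case=> _ -> -> [_ -> ->].
by case: s => -[-> ->] [-> ->].
Qed.

(** Straight edges have two even ends, while a half of an [inr i] has exactly one odd end, and this
    odd end determines [i]. *)
Lemma part_distinct d d' s a b a' b' : wf_desc n d -> wf_desc n d' -> d <> d' ->
  part n d s a b -> part n d' s a' b' -> ~ ((a = a' \/ a = b') /\ (b = a' \/ b = b')).
Proof.
case: d => [[s1 [x y]]|i]; case: d' => [[s2 [x' y']]|j] /=.
- move=> [h1 h2 _ _] [h3 h4 _ _] ne [e1 -> ->] [e2 -> ->] e; apply: ne.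
  by rewrite e1 e2; congr (inl (_, (_, _))); lia.
- by move=> [h1 h2 _ _] nj _ [_ -> ->]; case: s => -[-> ->]; wr.
- by move=> ni [h1 h2 _ _] _; case: s => -[-> ->] [_ -> ->]; wr.
- move=> ni nj ne.
  have {}ne : i <> j by move=> e; apply: ne; rewrite e.
  by case: s => -[-> ->] [-> ->]; wr.
Qed.

Lemma arcd_S2 d t : I01 t -> S2 (arcd n d t).
Proof.
by case: d => [[s [a b]]|i] It /=; [apply: (segarc_hemi s _ _ It).1 | apply: zz_S2].
Qed.

Lemma on_arc_S2 d y : on_arc (arcd n d) y -> S2 y.
Proof. by case=> t [It <-]; exact: arcd_S2. Qed.

Lemma on_arcd d s y : wf_desc n d -> S2 y -> 0 < sg s * snd y ->
  (on_arc (arcd n d) y <-> exists a b, part n d s a b /\ L a b (fst y) = 0).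
Proof.
case: d => [[s' [a b]]|i] /= w yS ys.
  case: w => ab _ _ _; have ab' : (2 * a)%N <> (2 * b)%N by lia.
  have [e|ne] := eqVneq s' s.
    rewrite e on_segarc //; last by split=> //; lra.
    by split=> [h|[u [v [[_ -> ->] h]]]] //; exists (2 * a)%N, (2 * b)%N.
  have -> : s' = ~~ s by move: ne; case: (s) (s') => -[].
  by split=> [/(segarc_opp yS ys)|[u [v [[/esym e _] _]]]] //; case: (s) e.
have [h1 h2 _] := zig_neq w.
have [H1 H2] := @on_zz_strict true (2 * i) _ (wrap n (2 * i + 6)) y (nesym h1) h2 yS.
case: s ys => ys; [rewrite H1 // | rewrite H2 //].
  by split=> [h|[u [v [[-> ->] h]]]] //; eexists; eexists; split; last exact: h.
by split=> [h|[u [v [[-> ->] h]]]] //; eexists; eexists; split; last exact: h.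
Qed.

Lemma arcd_interior d t : wf_desc n d -> 0 < t < 1 ->
  snd (arcd n d t) <> 0 \/ exists2 i, d = inr i & arcd n d t = cp (wrap n (2 * i + 3)).
Proof.
case: d => [[s [a b]]|i]; rewrite /arcd /wf_desc => w t01.
  left; have [ab _ _ _] := w; have ab' : (2 * a)%N <> (2 * b)%N by lia.
  by move=> e; have := @segarc_strict s _ _ t ab' t01; rewrite e; lra.
have [h1 h2 _] := zig_neq w.
have [h|[h|h]] := Rtotal_order t (1 / 2).
- left => e; have := @zz_strictL true _ _ (wrap n (2 * i + 6)) t h1 ltac:(lra).
  by rewrite e; lra.
- by right; exists i => //; rewrite h zz_half.
- left => e; have := @zz_strictR true (2 * i) _ _ t h2 ltac:(lra).
  by rewrite e; lra.
Qed.

Definition stops (d : desc) (k : nat) : Prop :=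
  match d with
  | inl (_, (a, b)) => k = (2 * a)%N \/ k = (2 * b)%N
  | inr i => [\/ k = (2 * i)%N, k = wrap n (2 * i + 3) | k = wrap n (2 * i + 6)]
  end.

Lemma on_arcd_circle d y : wf_desc n d -> on_arc (arcd n d) y -> snd y = 0 ->
  exists2 k, stops d k & y = cp k.
Proof.
have chord s a b : a <> b -> on_arc (segarc s a b) y -> snd y = 0 -> y = cp a \/ y = cp b.
  move=> ab [t [It <-]] /(segarc_z0 ab It) [] ->.
    by left; rewrite segarc0.
  by right; rewrite segarc1.
case: d => [[s [a b]]|i]; rewrite /arcd /wf_desc => w.
  have [ab _ _ _] := w; have ab' : (2 * a)%N <> (2 * b)%N by lia.
  by move=> /(chord _ _ _ ab') /[apply] -[->|->]; eexists; try reflexivity; [left | right].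
have [h1 h2 _] := zig_neq w.
case/on_zz => [/(chord _ _ _ h1)|/(chord _ _ _ h2)] /[apply] -[->|->]; eexists; try reflexivity.
- exact: Or31.
- exact: Or32.
- exact: Or32.
- exact: Or33.
Qed.

Lemma interior_on g y : interior_pt g y -> on_arc g y.
Proof. by case=> t [t01 <-]; exists t; split=> //; rewrite /I01; lra. Qed.

Lemma wrap6 i : (i < n)%N -> wrap n (2 * i + 6) = (2 * ((i + 3) %% n))%N.
Proof.
move=> ni; have [h|h] := ltnP (i + 3) n; first by rewrite modn_small //; wr.
rewrite -(subnK h) modnDr modn_small; last lia.
by wr.
Qed.

Lemma arcd_jordan d : wf_desc n d ->
  jordan_arc (arcd n d) (cp (2 * (dends n d).1)) (cp (2 * (dends n d).2)).
Proof.
case: d => [[s [a b]]|i] /= w.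
  by apply: segarc_jordan; case: w; lia.
by rewrite -wrap6 //; have [? ? ?] := zig_neq w; exact: zz_jordan.
Qed.

Lemma arcd_avoids d t v : wf_desc n d -> 0 < t < 1 -> arcd n d t <> cp (2 * v).
Proof.
move=> w t01 e; case: (arcd_interior w t01); first by rewrite e.
by case=> i di; rewrite e => /cp_inj; move: w; rewrite di /=; wr.
Qed.

(** An interior point of an edge lies on the equator only where some [inr i] changes hemisphere, and
    that odd point determines [i]. So all crossings lie in open hemispheres, where edges are
    chords. *)
Lemma common_interior d d' y : wf_desc n d -> wf_desc n d' -> d <> d' ->
  interior_pt (arcd n d) y -> interior_pt (arcd n d') y ->
  S2 y /\ exists s, 0 < sg s * snd y.
Proof.
move=> w w' ne yd yd'; split; first exact/on_arc_S2/interior_on/yd.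
have [z0|nz] := Req_dec (snd y) 0; last first.
  by have [z0|z0] := Rtotal_order (snd y) 0; [exists false | exists true] => /=; lra.
case: yd yd' => t [t01 yt] [t' [t01' yt']].
case: (arcd_interior w t01); first by rewrite yt.
case: (arcd_interior w' t01'); first by rewrite yt'.
move=> [j dj ej] [i di ei]; case: ne.
move: w w'; rewrite dj di /= => ni nj; congr inr.
by have /cp_inj : cp (wrap n (2 * i + 3)) = cp (wrap n (2 * j + 3)); [rewrite -ei -ej yt yt' | wr].
Qed.

Lemma common_strict d d' s y : wf_desc n d -> wf_desc n d' -> d <> d' ->
  S2 y -> 0 < sg s * snd y -> on_arc (arcd n d) y -> on_arc (arcd n d') y ->
  exists a b a' b' t, [/\ part n d s a b, part n d' s a' b', 0 < t < 1, y = segarc s a b t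
    & L a' b' (seg a b t) = 0].
Proof.
move=> w w' ne yS ys /(on_arcd w yS ys) [a [b [p La]]] /(on_arcd w' yS ys) [a' [b' [p' La']]].
exists a, b, a', b'.
have ab := part_neq w p.
have hy : hemi s y by split=> //; lra.
have [t [It e]] := (on_segarc ab hy).2 La.
exists t; split=> //; last by move: La'; rewrite -e.
have t0 : t <> 0 by move=> t0; move: ys; rewrite -e t0 segarc0 /=; lra.
have t1 : t <> 1 by move=> t1; move: ys; rewrite -e t1 segarc1 /=; lra.
by move: It; rewrite /I01; lra.
Qed.

(** The combinatorial trace of a crossing: crossing edges satisfy it by [common_desc_cross], so it
    suffices to exclude triples for this relation. *)
Definition desc_cross (d d' : desc) : Prop := exists s a b a' b',
  [/\ part n d s a b, part n d' s a' b' & interlaced a b a' b'].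

Lemma common_desc_cross d d' y : wf_desc n d -> wf_desc n d' -> d <> d' ->
  interior_pt (arcd n d) y -> interior_pt (arcd n d') y -> desc_cross d d'.
Proof.
move=> w w' ne yd yd'; have [yS [s ys]] := common_interior w w' ne yd yd'.
have [a [b [a' [b' [t [p p' t01 _ h]]]]]] :=
  common_strict w w' ne yS ys (interior_on yd) (interior_on yd').
exists s, a, b, a', b'; split=> //.
exact: (chords_cross t01 (part_neq w p) (part_distinct w w' ne p p') h).
Qed.

Lemma arcd_proper d d' y : wf_desc n d -> wf_desc n d' -> d <> d' ->
  interior_pt (arcd n d) y -> interior_pt (arcd n d') y ->
  proper_crossing (arcd n d) (arcd n d') y.
Proof.
move=> w w' ne yd yd'; have [yS [s ys]] := common_interior w w' ne yd yd'.
have [a [b [a' [b' [t [p p' t01 _ h]]]]]] :=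
  common_strict w w' ne yS ys (interior_on yd) (interior_on yd').
apply: (chords_proper_crossing (part_neq w p) (part_distinct w w' ne p p') yS ys
          (interior_on yd) (interior_on yd')).
  move=> z zS zs; rewrite (on_arcd w zS zs); split=> [[u [v [q Lq]]]|Lq].
    by have [<- <-] := part_uniq q p.
  by exists a, b.
move=> z zS zs; rewrite (on_arcd w' zS zs); split=> [[u [v [q Lq]]]|Lq].
  by have [<- <-] := part_uniq q p'.
by exists a', b'.
Qed.

Lemma strict_common_uniq d d' s y z : wf_desc n d -> wf_desc n d' -> d <> d' ->
  S2 y -> 0 < sg s * snd y -> on_arc (arcd n d) y -> on_arc (arcd n d') y ->
  S2 z -> 0 < sg s * snd z -> on_arc (arcd n d) z -> on_arc (arcd n d') z -> y = z.
Proof.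
move=> w w' ne yS ys yd yd' zS zs zd zd'.
have [a [b [a' [b' [t [p p' _ -> h]]]]]] := common_strict w w' ne yS ys yd yd'.
have [a2 [b2 [a2' [b2' [t2 [p2 p2' _ -> h2]]]]]] := common_strict w w' ne zS zs zd zd'.
have [e1 e2] := part_uniq p2 p; have [e3 e4] := part_uniq p2' p'; subst.
have [->//|tt] := Req_dec t t2.
by have := two_common (part_neq w p) tt h h2; have := part_distinct w w' ne p p'.
Qed.

(** An edge has at most three points on the equator, and two different edges share at most one point
    in each open hemisphere. *)
Lemma arcd_finite d d' : wf_desc n d -> wf_desc n d' -> d <> d' ->
  exists l : list pt, forall x, on_arc (arcd n d) x -> on_arc (arcd n d') x -> List.In x l.
Proof.
move=> w w' ne.
have [lc Hc] : exists l, forall x, on_arc (arcd n d) x -> snd x = 0 -> List.In x l.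
  case: d w {ne} => [[s [a b]]|i] w.
    exists [:: cp (2 * a); cp (2 * b)] => x xd /(on_arcd_circle w xd) [k /= hk ->].
    by case: hk => ->; auto.
  exists [:: cp (2 * i); cp (wrap n (2 * i + 3)); cp (wrap n (2 * i + 6))].
  move=> x xd /(on_arcd_circle w xd) [k /= hk ->].
  by case: hk => ->; auto.
have [ls Hs] : exists l : bool -> list pt, forall s x, S2 x -> 0 < sg s * snd x ->
    on_arc (arcd n d) x -> on_arc (arcd n d') x -> List.In x (l s).
  have H s : exists l : list pt, forall x, S2 x -> 0 < sg s * snd x ->
      on_arc (arcd n d) x -> on_arc (arcd n d') x -> List.In x l.
    have [[y [yS [ys [yd yd']]]]|no] := classic (exists y, S2 y /\ 0 < sg s * snd y /\
        on_arc (arcd n d) y /\ on_arc (arcd n d') y).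
      exists [:: y] => x xS xs xd xd'; left.
      exact: (strict_common_uniq w w' ne yS ys yd yd' xS xs xd xd').
    by exists nil => x xS xs xd xd'; apply: no; exists x.
  have [lt Ht] := H true; have [lf Hf] := H false.
  by exists (fun s => if s then lt else lf) => -[].
exists (lc ++ ls true ++ ls false)%list => x xd xd'.
rewrite !List.in_app_iff.
have [z0|[z0|z0]] := Rtotal_order (snd x) 0.
- by right; right; apply: Hs => //; [exact: on_arc_S2 xd | move=> /=; lra].
- by left; apply: Hc.
- by right; left; apply: Hs => //; [exact: on_arc_S2 xd | move=> /=; lra].
Qed.

(** Of the [2 * n] points, the halves of [inr i] cut off [2 * i + 1], [2 * i + 2] and [2 * i + 4],
    [2 * i + 5], cyclically. A chord between vertices that crosses a half therefore ends at the one
    vertex cut off, and its other end differs from the vertex at which that half ends. *)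
Lemma desc_cross_cases d d' : wf_desc n d -> wf_desc n d' -> desc_cross d d' ->
  match d, d' with
  | inl (s, (a, b)), inl (s', (a', b')) => s = s' /\ interlaced a b a' b'
  | inr i, inl (s, (a, b)) | inl (s, (a, b)), inr i =>
      if s then (2 * a = wrap n (2 * i + 2) \/ 2 * b = wrap n (2 * i + 2))%N /\
                a <> i /\ b <> i
      else (2 * a = wrap n (2 * i + 4) \/ 2 * b = wrap n (2 * i + 4))%N /\
           (2 * a)%N <> wrap n (2 * i + 6) /\ (2 * b)%N <> wrap n (2 * i + 6)
  | inr i, inr j => j = (i + 1)%N \/ i = (j + 1)%N \/
      i = 0%N /\ j = (n - 1)%N \/ j = 0%N /\ i = (n - 1)%N
  end.
Proof.
case: d => [[s1 [x y]]|i]; case: d' => [[s2 [x' y']]|j] w w' [s [a [b [a' [b' [p p' h]]]]]].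
- move: w w' p p' h => /= [? ? _ _] [? ? _ _] [-> -> ->] [-> -> ->].
  by rewrite /interlaced /between /outside; split=> //; lia.
- move: w w' p p' h => /= [? ? _ _] ? [-> -> ->].
  by case: s => -[-> ->]; rewrite /interlaced /between /outside; wr.
- move: w w' p p' h => /= ? [? ? _ _] p [-> -> ->]; move: p.
  by case: s => -[-> ->]; rewrite /interlaced /between /outside; wr.
- move: w w' p p' h => /= ? ?.
  by case: s => -[-> ->] [-> ->]; rewrite /interlaced /between /outside; wr.
Qed.

Lemma desc_cross_triple d1 d2 d3 : wf_desc n d1 -> wf_desc n d2 -> wf_desc n d3 ->
  desc_cross d1 d2 -> desc_cross d2 d3 -> desc_cross d1 d3 -> False.
Proof.
move=> w1 w2 w3 /(desc_cross_cases w1 w2) + /(desc_cross_cases w2 w3) + /(desc_cross_cases w1 w3).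
case: d1 w1 => [[s1 [a1 b1]]|i1] /= w1; case: d2 w2 => [[s2 [a2 b2]]|i2] /= w2;
  case: d3 w3 => [[s3 [a3 b3]]|i3] /= w3.
(* If three chords cross pairwise, the one with the largest left end [a] has [2 <= a] and two right
   ends of the others strictly between its ends, against [b <= a + 2]. *)
- case: w1 w2 w3 => [? ? ? _] [? ? ? _] [? ? ? _] [_ h1] [_ h2] [_ h3].
  by move: h1 h2 h3; rewrite /interlaced /between /outside; lia.
(* Two chords of one hemisphere that cross the same [inr i] both end at the vertex it cuts off
   there, so they do not cross each other. *)
- case: w1 w2 => [? ? ? _] [? ? ? _] [e h1] h2 h3; move: h1 h2 h3; rewrite e.
  by case: s2 {e} => + h2 h3; rewrite /interlaced /between /outside; move: h2 h3; wr.
- case: w1 w3 => [? ? ? _] [? ? ? _] h1 h2 [e h3]; move: h1 h2 h3; rewrite e.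
  by case: s3 {e} => h1 h2; rewrite /interlaced /between /outside; move: h1 h2; wr.
(* The two bent edges are cyclically consecutive. In either hemisphere the vertex cut off by one of
   them is an end of the other, so no chord crosses both. *)
- by case: w1 => [? ? ? _]; case: s1; wr.
- case: w2 w3 => [? ? ? _] [? ? ? _] h1 [e h2] h3; move: h1 h2 h3; rewrite e.
  by case: s3 {e} => h1 + h3; rewrite /interlaced /between /outside; move: h1 h3; wr.
- by case: w2 => [? ? ? _]; case: s2; wr.
- by case: w3 => [? ? ? _]; case: s3; wr.
(* Three indices cannot be pairwise cyclically consecutive when [4 <= n]. *)
- lia.
Qed.
End Edges.

(** * Lenses *)

(** Along the segment both functions stay positive, which keeps it off [C] in the open hemisphere.
    Nothing is assumed about [C] on the equator in between; by strict convexity of the disc the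
    segment touches the circle only at its ends, which are off [C]. *)
Lemma segment_same_region s (C : pt -> Prop) y w (g1 g2 : R * R -> R) :
  aff g1 -> aff g2 -> hemi s y -> ~ C y -> ~ C (cp w) ->
  0 < g1 (fst y) -> 0 < g2 (fst y) -> 0 < g1 (P w) -> 0 < g2 (P w) ->
  (forall x, S2 x -> 0 < sg s * snd x -> C x -> g1 (fst x) <= 0 \/ g2 (fst x) <= 0) ->
  same_region C y (cp w).
Proof.
move=> a1 a2 hy yC wC g1y g2y g1w g2w HC.
have [yD yE] := hemiE hy.
exists (fun t => lift s (mid (fst y) (P w) t)).
split; first by apply: mid_cont => //; exact: P_inD.
split; last by rewrite mid0 mid1 lift_P -yE.
move=> t It; have qD := mid_inD It yD (P_inD w).
have [qS qs] := hemi_lift s qD; split=> // qC.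
case: It => t0 t1.
have [/(HC _ qS)/(_ qC)|z0] : 0 < sg s * snd (lift s (mid (fst y) (P w) t)) \/
    sg s * snd (lift s (mid (fst y) (P w) t)) = 0 by move: qs; lra.
  rewrite [fst _]/= a1 a2.
  have pos p r : 0 < p -> 0 < r -> 0 < (1 - t) * p + t * r.
    by move=> p0 r0; have [h|h] := Rle_lt_dec t (1 / 2); nra.
  by have := pos _ _ g1y g1w; have := pos _ _ g2y g2w; lra.
have nz : 1 - (fst (mid (fst y) (P w) t) * fst (mid (fst y) (P w) t) +
    snd (mid (fst y) (P w) t) * snd (mid (fst y) (P w) t)) = 0.
  move: z0; rewrite lift_snd -Rmult_assoc sg_sqr Rmult_1_l => /sqrt_eq_0; apply.
  by move: qD; rewrite /inD; lra.
have yn : 0 <= 1 - (fst (fst y) * fst (fst y) + snd (fst y) * snd (fst y)).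
  by move: yD; rewrite /inD; lra.
have wn := P_norm w.
have [t00|[t11|e]] : t = 0 \/ t = 1 \/ fst y = P w.
- have [|nt0] := Req_dec t 0; first by left.
  have [|nt1] := Req_dec t 1; first by right; left.
  right; right.
  move: nz wn yn; case: (fst y) (P w) => p q [p' q']; rewrite /mid /= => nz wn yn.
  (* This rewrites that the point at parameter [t] has norm 1, using that [P w] has norm 1. The left
     side is nonnegative and the right side is not positive, so both vanish. *)
  have e : t * (1 - t) * ((p - p') * (p - p') + (q - q') * (q - q')) =
      - (1 - t) * (1 - (p * p + q * q)) by nra.
  have k : 0 < t * (1 - t) by nra.
  have k' : 0 <= (1 - t) * (1 - (p * p + q * q)) by nra.
  have k2 : (p - p') * (p - p') + (q - q') * (q - q') <= 0.
    by apply: (Rmult_le_reg_l (t * (1 - t))) => //; lra.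
  have s1 := Rle_0_sqr (p - p'); have s2 := Rle_0_sqr (q - q').
  have z1 : p - p' = 0 by apply: Rsqr_0_uniq; move: s1 s2; rewrite /Rsqr; lra.
  have z2 : q - q' = 0 by apply: Rsqr_0_uniq; move: s1 s2; rewrite /Rsqr; lra.
  by congr (_, _); lra.
- by apply: yC; move: qC; rewrite t00 mid0 -yE.
- by apply: wC; move: qC; rewrite t11 mid1 lift_P.
- apply: wC; move: qC; rewrite e.
  have -> : mid (P w) (P w) t = P w by rewrite /mid /P /=; congr (_, _); ring.
  by rewrite lift_P.
Qed.

(** [T] is the set of admissible targets among the [2 * n] points: the vertices, or all points when
    the path is to be continued in the other hemisphere. *)
Definition good (T : nat -> Prop) (s : bool) (C : pt -> Prop) : Prop :=
  forall y, hemi s y -> ~ C y -> exists w, [/\ T w, ~ C (cp w) & same_region C y (cp w)].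

(** Over the disc, [C] is the boundary of the wedge where both functions are nonnegative. Its
    complement is covered by three convex sets, [gA < 0], [gB < 0] and both positive, each of which
    misses [C]. The last two targets are demanded only if the set is inhabited, so that a constant
    [gB] describes a single chord. *)
Lemma good_gen T s (C : pt -> Prop) gA gB : aff gA -> aff gB ->
  (forall x, S2 x -> 0 < sg s * snd x -> C x ->
     gA (fst x) = 0 /\ 0 <= gB (fst x) \/ gB (fst x) = 0 /\ 0 <= gA (fst x)) ->
  (forall x, hemi s x -> gA (fst x) = 0 /\ 0 <= gB (fst x) \/
     gB (fst x) = 0 /\ 0 <= gA (fst x) -> C x) ->
  (exists w, [/\ T w, ~ C (cp w), 0 < gA (P w) & 0 < gB (P w)]) ->
  (forall y, hemi s y -> gA (fst y) < 0 -> exists w, [/\ T w, ~ C (cp w) & gA (P w) < 0]) ->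
  (forall y, hemi s y -> gB (fst y) < 0 -> exists w, [/\ T w, ~ C (cp w) & gB (P w) < 0]) ->
  good T s C.
Proof.
move=> aA aB H1 H2 [w [Tw Cw Aw Bw]] HA HB y hy yC.
have [yA|yA] := Rlt_le_dec (gA (fst y)) 0.
  have [w' [Tw' Cw' Aw']] := HA y hy yA; exists w'; split=> //.
  apply: (@segment_same_region s _ _ _ (fun q => - gA q) (fun q => - gA q)) => //;
    try lra; try exact: aff_opp.
  by move=> x xS xs /(H1 x xS xs); lra.
have [yB|yB] := Rlt_le_dec (gB (fst y)) 0.
  have [w' [Tw' Cw' Bw']] := HB y hy yB; exists w'; split=> //.
  apply: (@segment_same_region s _ _ _ (fun q => - gB q) (fun q => - gB q)) => //;
    try lra; try exact: aff_opp.
  by move=> x xS xs /(H1 x xS xs); lra.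
exists w; split=> //.
have nA : gA (fst y) <> 0 by move=> e; apply/yC/H2 => //; left.
have nB : gB (fst y) <> 0 by move=> e; apply/yC/H2 => //; right.
apply: (@segment_same_region s _ _ _ gA gB) => //; try lra.
by move=> x xS xs /(H1 x xS xs); lra.
Qed.

Definition same_side (a b r t : nat) : Prop :=
  between a b r /\ between a b t \/ outside a b r /\ outside a b t.

(* [L a b], with the sign that makes it positive at [P r]. *)
Definition Lr (a b r : nat) (q : R * R) : R :=
  (if ((a < r < b) || (b < r < a))%N then -1 else 1) * L a b q.

Lemma Lr_aff a b r : aff (Lr a b r).
Proof. exact/aff_scale/L_aff. Qed.

Lemma Lr_eq0 a b r q : Lr a b r q = 0 <-> L a b q = 0.
Proof. by rewrite /Lr; case: ifP => _; lra. Qed.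

Lemma Lr_same_side a b r t : same_side a b r t -> 0 < Lr a b r (P t).
Proof.
rewrite /Lr => -[[hr /L_neg h]|[hr /L_pos h]]; case: ifP => k; try lra.
  by move: hr k; rewrite /between; lia.
by move: hr k; rewrite /outside; lia.
Qed.

Lemma Lr_interlaced a b r t : interlaced a b r t -> Lr a b r (P t) < 0.
Proof.
rewrite /Lr => -[[hr /L_pos h]|[hr /L_neg h]]; case: ifP => k; try lra.
  by move: hr k; rewrite /between; lia.
by move: hr k; rewrite /outside; lia.
Qed.

Lemma Lr_ref a b r : r <> a -> r <> b -> 0 < Lr a b r (P r).
Proof. by move=> ra rb; apply: Lr_same_side; rewrite /same_side /between /outside; lia. Qed.

Definition sub (g : R -> pt) (u v : R) (x : pt) : Prop := exists t, u <= t <= v /\ g t = x.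

(** Describes the piece of a chord from an inner point to an end by a sign condition, the form
    required by [good_gen]; [g] will be the function of the other chord through the corner. *)
Lemma sub_segarc s a b u (g : R * R -> R) x : a <> b -> 0 <= u < 1 -> aff g ->
  g (seg a b u) = 0 -> 0 < g (P b) -> hemi s x ->
  (sub (segarc s a b) u 1 x <-> L a b (fst x) = 0 /\ 0 <= g (fst x)).
Proof.
move=> ab [u0 u1] ga gu gb hx.
have e t : (1 - u) * g (seg a b t) = (t - u) * g (P b).
  by move: gu; rewrite /seg !ga => /(congr1 (Rmult (1 - t))); lra.
split=> [[t [[ut t1] <-]]|[Lx gx]].
  split; first exact: L_seg.
  rewrite [fst _]/=; apply: (Rmult_le_reg_l (1 - u)); first lra.
  by rewrite e; nra.
have [t [[t0 t1] xt]] := (on_segarc ab hx).2 Lx.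
exists t; split=> //; split=> //.
have : 0 <= (1 - u) * g (seg a b t) by apply: Rmult_le_pos; [lra | move: gx; rewrite -xt].
by rewrite e; nra.
Qed.

Lemma sub_segarc_full s a b x : a <> b -> hemi s x ->
  (sub (segarc s a b) 0 1 x <-> L a b (fst x) = 0).
Proof. by move=> ab hx; rewrite -(on_segarc ab hx). Qed.

(** The case of two pieces issuing from a corner, one running to [m] and the other to [q]: each
    piece is the part of its chord on the positive side of the other. *)
Lemma good_V T s (C : pt -> Prop) a m c q u v :
  a <> m -> c <> q -> m <> c -> m <> q -> q <> a ->
  0 <= u < 1 -> 0 <= v < 1 -> segarc s a m u = segarc s c q v ->
  (forall x, sub (segarc s a m) u 1 x -> C x) ->
  (forall x, sub (segarc s c q) v 1 x -> C x) ->
  (forall x, S2 x -> 0 < sg s * snd x -> C x ->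
     sub (segarc s a m) u 1 x \/ sub (segarc s c q) v 1 x) ->
  (exists w, [/\ T w, ~ C (cp w), same_side a m q w & same_side c q m w]) ->
  (exists w, [/\ T w, ~ C (cp w) & interlaced a m q w]) ->
  ((exists w, [/\ T w, ~ C (cp w) & interlaced c q m w])) ->
  good T s C.
Proof.
move=> am cq mc mq qa u01 v01 /(congr1 fst) /= e CA CB CAB [w [Tw Cw w1 w2]] [wA [TA cA oA]] [wB [TB cB oB]].
have sA x : hemi s x -> (sub (segarc s a m) u 1 x <-> Lr a m q (fst x) = 0 /\ 0 <= Lr c q m (fst x)).
  rewrite Lr_eq0; apply: sub_segarc => //; first exact: Lr_aff.
    by rewrite e; apply/Lr_eq0/L_seg.
  exact: Lr_ref.
have sB x : hemi s x -> (sub (segarc s c q) v 1 x <-> Lr c q m (fst x) = 0 /\ 0 <= Lr a m q (fst x)).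
  rewrite Lr_eq0; apply: sub_segarc => //; first exact: Lr_aff.
    by rewrite -e; apply/Lr_eq0/L_seg.
  by apply: Lr_ref => //; exact/nesym.
apply: (@good_gen _ _ _ (Lr a m q) (Lr c q m)); try exact: Lr_aff.
- move=> x xS xs /(CAB x xS xs).
  by have hx : hemi s x; [split=> //; lra | rewrite sA // sB].
- by move=> x hx [/(sA x hx) /CA|/(sB x hx) /CB].
- by exists w; split=> //; exact: Lr_same_side.
- by move=> _ _ _; exists wA; split=> //; exact: Lr_interlaced.
- by move=> _ _ _; exists wB; split=> //; exact: Lr_interlaced.
Qed.

Lemma good_I T s (C : pt -> Prop) a b : a <> b ->
  (forall x, sub (segarc s a b) 0 1 x -> C x) ->
  (forall x, S2 x -> 0 < sg s * snd x -> C x -> sub (segarc s a b) 0 1 x) ->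
  (exists w w', [/\ T w, ~ C (cp w), T w', ~ C (cp w') & interlaced a b w w']) ->
  good T s C.
Proof.
move=> ab CA CAB [w [w' [Tw Cw Tw' Cw' o]]].
apply: (@good_gen _ _ _ (Lr a b w) (fun=> 1)); [exact: Lr_aff | exact: aff_const | | | | | ].
- move=> x xS xs /(CAB x xS xs).
  by rewrite sub_segarc_full // => [/Lr_eq0 h|]; [left; split; [exact: h | lra] | split=> //; lra].
- by move=> x hx [[/Lr_eq0 h _]|[]]; [apply: CA; rewrite sub_segarc_full | lra].
- exists w; split=> //; last lra.
  by apply: Lr_ref; move: o; rewrite /interlaced /between /outside; lia.
- by move=> _ _ _; exists w'; split=> //; exact: Lr_interlaced.
- by move=> _ _; lra.
Qed.

(** The case of two disjoint chords: each lies entirely on the positive side of the other, and the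
    wedge of [good_gen] becomes the strip between them. *)
Lemma good_II T s (C : pt -> Prop) a b c d :
  a <> b -> c <> d -> same_side a b c d -> same_side c d a b ->
  (forall x, sub (segarc s a b) 0 1 x -> C x) ->
  (forall x, sub (segarc s c d) 0 1 x -> C x) ->
  (forall x, S2 x -> 0 < sg s * snd x -> C x ->
     sub (segarc s a b) 0 1 x \/ sub (segarc s c d) 0 1 x) ->
  (exists w, [/\ T w, ~ C (cp w), same_side a b c w & same_side c d a w]) ->
  (exists w, [/\ T w, ~ C (cp w) & interlaced a b c w]) ->
  (exists w, [/\ T w, ~ C (cp w) & interlaced c d a w]) ->
  good T s C.
Proof.
move=> ab cd sab scd CA CB CAB [w [Tw Cw w1 w2]] [wA [TA cA oA]] [wB [TB cB oB]].
have pos a' b' c' d' t : I01 t -> same_side c' d' a' b' -> 0 <= Lr c' d' a' (seg a' b' t).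
  move=> [t0 t1] h; rewrite /seg Lr_aff.
  have := Lr_same_side h; have : 0 < Lr c' d' a' (P a').
    by apply: Lr_ref; move: h; rewrite /same_side /between /outside; lia.
  by move=> p1 p2; nra.
apply: (@good_gen _ _ _ (Lr a b c) (Lr c d a)); try exact: Lr_aff.
- move=> x xS xs /(CAB x xS xs) [] [t [It <-]]; rewrite [fst _]/=.
    by left; split; [apply/Lr_eq0/L_seg | exact: pos].
  by right; split; [apply/Lr_eq0/L_seg | exact: pos].
- by move=> x hx [[/Lr_eq0 h _]|[/Lr_eq0 h _]]; [apply: CA | apply: CB];
    rewrite sub_segarc_full.
- by exists w; split=> //; exact: Lr_same_side.
- by move=> _ _ _; exists wA; split=> //; exact: Lr_interlaced.
- by move=> _ _ _; exists wB; split=> //; exact: Lr_interlaced.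
Qed.

(* The sides of the lens [C], oriented so that they run between the same corners. *)
Definition bigon (g h : R -> pt) (a1 a2 b1 b2 : R) (C : pt -> Prop) : Prop :=
  [/\ 0 <= a1 /\ a1 < a2 /\ a2 <= 1, 0 <= b1 /\ b1 < b2 /\ b2 <= 1, g a1 = h b1,
      g a2 = h b2 & forall x, C x <-> sub g a1 a2 x \/ sub h b1 b2 x].

Lemma sub_rev g g' u v x : (forall t, g (1 - t) = g' t) ->
  (sub g u v x <-> sub g' (1 - v) (1 - u) x).
Proof.
move=> e; split=> -[t [uv <-]]; exists (1 - t); split; try lra.
  by rewrite -e; congr g; lra.
by rewrite e.
Qed.

Lemma bigon_swap g h a1 a2 b1 b2 C : bigon g h a1 a2 b1 b2 C -> bigon h g b1 b2 a1 a2 C.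
Proof. by case=> ? ? e1 e2 H; split=> // x; rewrite H; split=> -[]; auto. Qed.

Lemma bigon_rev g g' h h' a1 a2 b1 b2 C :
  (forall t, g (1 - t) = g' t) -> (forall t, h (1 - t) = h' t) ->
  bigon g h a1 a2 b1 b2 C -> bigon g' h' (1 - a2) (1 - a1) (1 - b2) (1 - b1) C.
Proof.
move=> eg eh [ha hb e1 e2 H]; split; try lra.
- by rewrite -eg -eh; replace (1 - (1 - a2)) with a2 by ring; replace (1 - (1 - b2)) with b2 by ring.
- by rewrite -eg -eh; replace (1 - (1 - a1)) with a1 by ring; replace (1 - (1 - b1)) with b1 by ring.
- by move=> x; rewrite H (sub_rev a1 a2 x eg) (sub_rev b1 b2 x eh).
Qed.

(** The sign of the height reveals the half to which a parameter belongs; comparing two edges at a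
    common point then relates their parameters. *)
Lemma zz_sign s a m b t : a <> m -> m <> b -> I01 t ->
  0 < t < 1 / 2 /\ 0 < sg s * snd (zz s a m b t) \/
  1 / 2 < t < 1 /\ sg s * snd (zz s a m b t) < 0 \/
  snd (zz s a m b t) = 0 /\
    (t = 0 /\ zz s a m b t = cp a \/ t = 1 / 2 /\ zz s a m b t = cp m \/
     t = 1 /\ zz s a m b t = cp b).
Proof.
move=> am mb It; case: (zz_case It) => [->|[h|[->|[h|->]]]].
- by right; right; rewrite zz0; split=> //; left.
- by left; split=> //; exact: zz_strictL.
- by right; right; rewrite zz_half; split=> //; right; left.
- by right; left; split=> //; exact: zz_strictR.
- by right; right; rewrite zz1; split=> //; right; right.
Qed.

Lemma segarc_sign s a b t : a <> b -> I01 t ->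
  0 < t < 1 /\ 0 < sg s * snd (segarc s a b t) \/
  snd (segarc s a b t) = 0 /\
    (t = 0 /\ segarc s a b t = cp a \/ t = 1 /\ segarc s a b t = cp b).
Proof.
move=> ab [t0 t1]; have [->|n0] := Req_dec t 0.
  by right; rewrite segarc0; split=> //; left.
have [->|n1] := Req_dec t 1; first by right; rewrite segarc1; split=> //; right.
have t01 : 0 < t < 1 by lra.
by left; split=> //; exact: segarc_strict.
Qed.

Lemma sub_zz_half s a m b u v x : v <= 1 / 2 ->
  (sub (zz s a m b) u v x <-> sub (segarc s a m) (2 * u) (2 * v) x).
Proof.
move=> v2; split=> -[t [uv <-]].
  by exists (2 * t); rewrite zzL; [split=> //; lra | lra].
by exists (t / 2); rewrite zzL; [split; [lra | congr segarc; field] | lra].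
Qed.

Lemma sub_zz_first s a m b u v x : m <> b -> 0 <= u <= 1 / 2 -> 1 / 2 <= v <= 1 ->
  (sub (segarc s a m) (2 * u) 1 x -> sub (zz s a m b) u v x) /\
  (0 < sg s * snd x -> sub (zz s a m b) u v x -> sub (segarc s a m) (2 * u) 1 x).
Proof.
move=> mb u2 v2; split.
  move=> [t [uv <-]].
  by exists (t / 2); rewrite zzL; [split; [lra | congr segarc; field] | lra].
move=> xs [t [uv e]]; have [h|h] := Rle_lt_dec t (1 / 2).
  by exists (2 * t); rewrite -e zzL; [split=> //; lra | lra].
have [t1|t1] : t = 1 \/ t < 1 by lra.
  by move: xs; rewrite -e t1 zz1 /=; lra.
by have := @zz_strictR s a m b t mb ltac:(lra); rewrite e; lra.
Qed.

Lemma sub_segarc_opp s a b u v x : 0 <= u -> v <= 1 -> 0 < sg (~~ s) * snd x ->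
  ~ sub (segarc s a b) u v x.
Proof.
move=> u0 v1 xs [t [uv e]].
have It : I01 t by rewrite /I01; lra.
by have [_] := segarc_hemi s a b It; rewrite e; move: xs; rewrite sgN; lra.
Qed.

(** [condV], [condI] and [condII] are the parts of [good_V], [good_I] and [good_II] that speak of
    indices only; the points lying on the lens are removed from [T] beforehand by [less]. *)
Definition condV (T : nat -> Prop) (a m c q : nat) : Prop :=
  [/\ exists w, [/\ T w, same_side a m q w & same_side c q m w],
      exists w, T w /\ interlaced a m q w & exists w, T w /\ interlaced c q m w].

Definition condI (T : nat -> Prop) (a b : nat) : Prop :=
  exists w w', [/\ T w, T w' & interlaced a b w w'].

Definition condII (T : nat -> Prop) (a b c d : nat) : Prop :=
  [/\ same_side a b c d, same_side c d a b & exists w, [/\ T w, same_side a b c w & same_side c d a w]] /\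
  (exists w, T w /\ interlaced a b c w) /\ (exists w, T w /\ interlaced c d a w).

Lemma good_mono (T T' : nat -> Prop) s C : (forall w, T w -> T' w) -> good T s C -> good T' s C.
Proof. by move=> TT' H y hy yC; have [w [Tw Cw yw]] := H y hy yC; exists w; split=> //; exact: TT'. Qed.

Lemma sub_zz_circle s a m b u v w : a <> m -> m <> b -> 0 <= u -> v <= 1 ->
  sub (zz s a m b) u v (cp w) -> w = a /\ u <= 0 \/ w = m /\ 1 / 2 <= v \/ w = b /\ 1 <= v.
Proof.
move=> am mb u0 v1 [t [uv e]].
have It : I01 t by rewrite /I01; lra.
have := zz_sign s am mb It; rewrite e /= => -[[_]|[[_]|[_]]]; try lra.
case=> [[t0 /cp_inj]|[[t2 /cp_inj]|[t1 /cp_inj]]] k; [left | right; left | right; right];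
  split=> //; lra.
Qed.

Lemma sub_segarc_circle s a b u v w : a <> b -> 0 <= u -> v <= 1 ->
  sub (segarc s a b) u v (cp w) -> w = a /\ u <= 0 \/ w = b /\ 1 <= v.
Proof.
move=> ab u0 v1 [t [uv e]].
have It : I01 t by rewrite /I01; lra.
have := segarc_sign s ab It; rewrite e /= => -[[_]|[_]]; first lra.
case=> [[t0 /cp_inj]|[t1 /cp_inj]] k; [left | right]; split=> //; lra.
Qed.

Definition less (T S : nat -> Prop) (w : nat) : Prop := T w /\ ~ S w.

(** * Lenses with a straight side *)

Section Bigons.
Variables (C : pt -> Prop) (T T' : nat -> Prop).

(** The second corner must be the common end [b], and the first is the common end [a] or a crossing
    in the hemisphere [s]. So the lens consists of two pieces from a corner in [s] and of the full
    chord from [m] to [b] in the other hemisphere. *)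
Lemma zig_chord s a m b c d a1 a2 b1 b2 :
  a <> m -> m <> b -> a <> b -> c <> d -> m <> c -> m <> d ->
  bigon (zz s a m b) (segarc s c d) a1 a2 b1 b2 C ->
  (d = b -> c = a \/ interlaced a m c b ->
   let S w := w = m \/ w = b \/ w = a /\ c = a in
   condV (less T S) a m c b /\ condI (less T' S) m b) ->
  good T s C /\ good T' (~~ s) C.
Proof.
move=> am mb ab cd mc md [ha hb e1 e2 HC] cond.
have common t t' : I01 t -> I01 t' -> zz s a m b t = segarc s c d t' ->
    t < 1 / 2 \/ t = 1 /\ (t' = 0 \/ t' = 1 /\ d = b).
  move=> It It' e.
  have := zz_sign s am mb It; have := segarc_sign s cd It'; rewrite e.
  case=> [[? ?]|[z0 hc]] [[? ?]|[[? ?]|[z0' hz]]]; try (by left; lra); try nra.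
  case: hz => [[t0 _]|[[_ k]|[t1 k]]]; [by left; lra | | right].
    by move: hc; rewrite k => -[] [_ /cp_inj].
  split=> //; case: hc => [[t0' _]|[t1' k']]; [by left | right].
  by split=> //; apply: cp_inj; rewrite -k -k'.
have Ia1 : I01 a1 by rewrite /I01; lra.
have Ia2 : I01 a2 by rewrite /I01; lra.
have Ib1 : I01 b1 by rewrite /I01; lra.
have Ib2 : I01 b2 by rewrite /I01; lra.
have a1h : a1 < 1 / 2 by case: (common _ _ Ia1 Ib1 e1) => //; lra.
have E1 : segarc s a m (2 * a1) = segarc s c d b1 by rewrite -(zzL s a m b) //; lra.
have Lcd t t' : segarc s a m t = segarc s c d t' -> L c d (seg a m t) = 0.
  by move=> /(congr1 fst) /= ->; exact: L_seg.
(* Both corners in the first half would be two common points of distinct chords. *)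
have [a21 [b21 db]] : a2 = 1 /\ b2 = 1 /\ d = b.
  case: (common _ _ Ia2 Ib2 e2) => [a2h|[-> [b20|[-> ->]]]] //; last lra.
  have E2 : segarc s a m (2 * a2) = segarc s c d b2 by rewrite -(zzL s a m b) //; lra.
  have n12 : 2 * a1 <> 2 * a2 by lra.
  by have := two_common am n12 (Lcd _ _ E1) (Lcd _ _ E2); lia.
subst d a2 b2.
have b11 : b1 < 1 by lra.
have ca0 : a1 = 0 -> c = a.
  move=> a10; move: e1; rewrite a10 zz0 => e1.
  have := segarc_sign s cd Ib1; rewrite -e1 /= => -[[_]|[_ [[_ /cp_inj //]|]]]; lra.
have fact : c = a \/ interlaced a m c b.
  have [a10|a10] : a1 = 0 \/ 0 < a1 by lra.
    by left; exact: ca0.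
  right; apply: (chords_cross (s := 2 * a1)) => //; [lra | lia | exact: Lcd E1].
have [[[w [Tw w1 w2]] [wA [TA oA]] [wB [TB oB]]] [w' [w'' [T1 T2 o]]]] := cond erefl fact.
pose S w := w = m \/ w = b \/ w = a /\ c = a.
have SC v : C (cp v) -> S v.
  case/HC => [/(@sub_zz_circle s a m b a1 1 v am mb ltac:(lra) ltac:(lra)) [[va u0]|[[vm _]|[vb _]]]|].
  - by right; right; split=> //; apply: ca0; lra.
  - by left.
  - by right; left.
  case/(@sub_segarc_circle s c b b1 1 v cd ltac:(lra) ltac:(lra)) => -[vc u0]; last by right; left.
  have b10 : b1 = 0 by lra.
  move: e1; rewrite b10 segarc0 zzL; last lra.
  move=> /esym e1; have := @segarc_sign s a m (2 * a1) am ltac:(rewrite /I01; lra).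
  rewrite -e1 /= => -[[_]|[_ [[a10 _]|]]]; try lra.
  by right; right; have ca := ca0 ltac:(lra); rewrite vc ca.
have TC v : less T S v -> ~ C (cp v).
  by move=> [_ h] /SC.
have TC' v : less T' S v -> ~ C (cp v).
  by move=> [_ h] /SC.
have hu : 0 <= 2 * a1 < 1 by lra.
have sL x := @sub_zz_first s a m b a1 1 x mb ltac:(lra) ltac:(lra).
split.
  apply: (@good_mono (less T S)) => [? [] //|].
  apply: (@good_V _ _ _ a m c b (2 * a1) b1) => //; try by [lra | lia].
  - by move=> x h; apply/HC; left; apply: (sL x).1.
  - by move=> x h; apply/HC; right.
  - by move=> x xS xs /HC [/((sL x).2 xs)|]; auto.
  - by exists w; split=> //; exact: TC.
  - by exists wA; split=> //; exact: TC.
  - by exists wB; split=> //; exact: TC.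
have rv u v x := sub_rev u v x (zz_rev s a m b).
have sR x := @sub_zz_first (~~ s) b m a 0 (1 - a1) x (nesym am) ltac:(lra) ltac:(lra).
apply: (@good_mono (less T' S)) => [? [] //|].
apply: (@good_I _ _ _ b m); first exact: nesym.
- move=> x h; apply/HC; left; apply/rv.
  by rewrite Rminus_diag; apply: (sR x).1; rewrite Rmult_0_r.
- move=> x xS xs /HC [/rv|/sub_segarc_opp]; last by move=> k; case: k => //; lra.
  by rewrite Rminus_diag => /((sR x).2 xs); rewrite Rmult_0_r.
- exists w', w''; split=> //; try exact: TC'.
  by move: o; rewrite /interlaced /between /outside; lia.
Qed.

Lemma chord_chord s c d a1 a2 b1 b2 : c <> d ->
  bigon (segarc s c d) (segarc (~~ s) c d) a1 a2 b1 b2 C ->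
  condI (less T (fun w => w = c \/ w = d)) c d ->
  condI (less T' (fun w => w = c \/ w = d)) c d -> good T s C /\ good T' (~~ s) C.
Proof.
move=> cd [ha hb e1 e2 HC] [w [w' [Tw Tw' o]]] [v [v' [Tv Tv' o']]].
have common t t' : I01 t -> I01 t' -> segarc s c d t = segarc (~~ s) c d t' ->
    t = 0 /\ t' = 0 \/ t = 1 /\ t' = 1.
  move=> It It' e.
  have := segarc_sign s cd It; have := segarc_sign (~~ s) cd It'; rewrite e sgN.
  case=> [[? ?]|[z0 hc]] [[? ?]|[z0' hz]]; try nra.
  by case: hc hz => -[-> k] [] [-> k']; auto; case: cd; apply: cp_inj; rewrite -k -k'.
have I1 x : 0 <= x -> x <= 1 -> I01 x by rewrite /I01.
have [[z1 z2]|[z1 _]] := common a1 b1 ltac:(apply: I1; lra) ltac:(apply: I1; lra) e1;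
  last by exfalso; lra.
have [[z3 _]|[z3 z4]] := common a2 b2 ltac:(apply: I1; lra) ltac:(apply: I1; lra) e2;
  first by exfalso; lra.
subst.
pose S w := w = c \/ w = d.
have SC x : C (cp x) -> S x.
  have H s0 := @sub_segarc_circle s0 c d 0 1 x cd ltac:(lra) ltac:(lra).
  by case/HC => /H [[-> _]|[-> _]]; rewrite /S; auto.
split; [apply: (@good_mono (less T S)) => [? [] //|] |
  apply: (@good_mono (less T' S)) => [? [] //|]];
  apply: (@good_I _ _ _ c d) => //.
- by move=> x h; apply/HC; left.
- by move=> x xS xs /HC [//|/sub_segarc_opp k]; case: k => //; [lra|lra|rewrite negbK].
- by exists w, w'; split=> // /SC; [case: Tw | case: Tw'].
- by move=> x h; apply/HC; right.
- by move=> x xS xs /HC [/sub_segarc_opp k|//]; case: k => //; lra.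
- by exists v, v'; split=> // /SC; [case: Tv | case: Tv'].
Qed.
End Bigons.

(** What holds for two different edges of the form [inr]: the only points of the equator they can
    share are the start of one and the end of the other. *)
Definition apart (a m b a' m' b' : nat) : Prop :=
  a <> m /\ m <> b /\ a' <> m' /\ m' <> b' /\ m <> a' /\ m <> m' /\ m <> b' /\
  m' <> a /\ m' <> b /\ a <> a' /\ b <> b'.

Lemma apart_swap a m b a' m' b' : apart a m b a' m' b' -> apart a' m' b' a m b.
Proof. rewrite /apart; lia. Qed.

Lemma apart_rev a m b a' m' b' : apart a m b a' m' b' -> apart b m a b' m' a'.
Proof. rewrite /apart; lia. Qed.

(** * Lenses with two bent sides *)

Section ZigZag.
Variables (s : bool) (a m b a' m' b' : nat).
Hypothesis G : apart a m b a' m' b'.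

Let am : a <> m. Proof. by case: G; tauto. Qed.
Let mb : m <> b. Proof. by case: G; tauto. Qed.
Let am' : a' <> m'. Proof. by case: G; tauto. Qed.
Let mb' : m' <> b'. Proof. by case: G; tauto. Qed.
Let ma' : m <> a'. Proof. by case: G; tauto. Qed.
Let mm' : m <> m'. Proof. by case: G; tauto. Qed.
Let mb2 : m <> b'. Proof. by case: G; tauto. Qed.
Let m'a : m' <> a. Proof. by case: G; tauto. Qed.
Let m'b : m' <> b. Proof. by case: G; tauto. Qed.
Let aa' : a <> a'. Proof. by case: G; tauto. Qed.
Let bb' : b <> b'. Proof. by case: G; tauto. Qed.

Lemma zz_common t t' : I01 t -> I01 t' -> zz s a m b t = zz s a' m' b' t' ->
  (0 < t < 1 / 2 /\ 0 < t' < 1 / 2) \/ (1 / 2 < t < 1 /\ 1 / 2 < t' < 1) \/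
  (t = 0 /\ t' = 1 /\ a = b') \/ (t = 1 /\ t' = 0 /\ b = a').
Proof.
move=> It It' e.
have := zz_sign s am' mb' It'; have := zz_sign s am mb It; rewrite e.
case=> [[? ?]|[[? ?]|[z h]]] [[? ?]|[[? ?]|[z' h']]]; try nra.
case: h h' => [[? ->]|[[? ->]|[? ->]]] [[? /cp_inj ?]|[[? /cp_inj ?]|[? /cp_inj ?]]];
  try lia.
- by right; right; left.
- by right; right; right.
Qed.

Lemma zz_first_line t t' : t <= 1 / 2 -> t' <= 1 / 2 -> zz s a m b t = zz s a' m' b' t' ->
  segarc s a m (2 * t) = segarc s a' m' (2 * t') /\ L a' m' (seg a m (2 * t)) = 0.
Proof.
move=> h h'; rewrite !zzL // => e; split=> //.
by move: e => /(congr1 fst) /= ->; exact: L_seg.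
Qed.

Lemma zz_first_uniq t1 t2 t1' t2' : t1 <= 1 / 2 -> t1' <= 1 / 2 -> t2 <= 1 / 2 -> t2' <= 1 / 2 ->
  zz s a m b t1 = zz s a' m' b' t1' -> zz s a m b t2 = zz s a' m' b' t2' -> t1 = t2.
Proof.
move=> h1 h1' h2 h2' /(zz_first_line h1 h1') [_ e1] /(zz_first_line h2 h2') [_ e2].
have [//|n12] := Req_dec t1 t2.
have n12' : 2 * t1 <> 2 * t2 by lra.
by have := two_common am n12' e1 e2; lia.
Qed.

Lemma zz_first_cross t t' : 0 < t < 1 / 2 -> t' <= 1 / 2 ->
  zz s a m b t = zz s a' m' b' t' -> interlaced a m a' m'.
Proof.
move=> h h' /zz_first_line [||_ e]; try lra.
by apply: (chords_cross (s := 2 * t)) => //; [lra | lia].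
Qed.

Lemma zz_half_good (C : pt -> Prop) (T : nat -> Prop) u v u' v' :
  (forall w, T w -> ~ C (cp w)) ->
  0 < u < 1 / 2 -> 1 / 2 <= v <= 1 -> 0 < u' < 1 / 2 -> 1 / 2 <= v' <= 1 ->
  zz s a m b u = zz s a' m' b' u' ->
  (forall x, C x <-> sub (zz s a m b) u v x \/ sub (zz s a' m' b') u' v' x) ->
  condV T a m a' m' -> good T s C.
Proof.
move=> TC hu hv hu' hv' e HC [[w [Tw w1 w2]] [wA [TA oA]] [wB [TB oB]]].
have [E _] := zz_first_line (t := u) (t' := u') ltac:(lra) ltac:(lra) e.
have sL x := @sub_zz_first s a m b u v x mb ltac:(lra) hv.
have sL' x := @sub_zz_first s a' m' b' u' v' x mb' ltac:(lra) hv'.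
apply: (@good_V _ _ _ a m a' m' (2 * u) (2 * u')) => //; try lra.
- by move=> x h; apply/HC; left; apply: (sL x).1.
- by move=> x h; apply/HC; right; apply: (sL' x).1.
- by move=> x xS xs /HC [/((sL x).2 xs)|/((sL' x).2 xs)]; auto.
- by exists w; split=> //; exact: TC.
- by exists wA; split=> //; exact: TC.
- by exists wB; split=> //; exact: TC.
Qed.

(* Both edges leave a common vertex, one along its first half and the other backwards
   along its last half, until they cross in the hemisphere [s]. *)
Lemma zig_zig_corner (C : pt -> Prop) (T : nat -> Prop) a2 b2 :
  bigon (zz s a m b) (zz (~~ s) b' m' a') 0 a2 0 b2 C -> a2 < 1 / 2 -> 1 / 2 < b2 < 1 ->
  condV (less T (fun w => w = a \/ w = m')) m a a' m' ->
  condI (less T (fun w => w = a \/ w = m')) a m' -> good T s C /\ good T (~~ s) C.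
Proof.
move=> [ha hb e1 e2 HC] a2h b2h [[w [Tw w1 w2]] [wA [TA oA]] [wB [TB oB]]].
move=> [w' [w'' [T1 T2 o]]].
have ab' : a = b' by apply: cp_inj; rewrite -(zz0 s a m b) e1 zz0.
have rv x : sub (zz (~~ s) b' m' a') 0 b2 x <-> sub (zz s a' m' b') (1 - b2) 1 x.
  by rewrite (sub_rev 0 b2 x (zz_rev (~~ s) b' m' a')) negbK Rminus_0_r.
have sA x : sub (zz s a m b) 0 a2 x <-> sub (segarc s m a) (1 - 2 * a2) 1 x.
  rewrite sub_zz_half; last lra.
  by rewrite (sub_rev _ _ x (segarc_rev s a m)) Rmult_0_r Rminus_0_r.
have sB x := @sub_zz_first s a' m' b' (1 - b2) 1 x mb' ltac:(lra) ltac:(lra).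
have sB' x := @sub_zz_first (~~ s) b' m' a' 0 b2 x (nesym am') ltac:(lra) ltac:(lra).
have e2' : zz s a m b a2 = zz s a' m' b' (1 - b2) by rewrite e2 zz_rev.
have [E _] := zz_first_line (t := a2) (t' := 1 - b2) ltac:(lra) ltac:(lra) e2'.
pose S w := w = a \/ w = m'.
have TC v : less T S v -> ~ C (cp v).
  have H := @sub_zz_circle s a m b 0 a2 v am mb ltac:(lra) ltac:(lra).
  have H' := @sub_zz_circle (~~ s) b' m' a' 0 b2 v (nesym mb') (nesym am') ltac:(lra) ltac:(lra).
  move=> [_ h] /HC [/H|/H'] [[e _]|[[e ?]|[_ ?]]]; try lra; apply: h; rewrite /S; lia.
split; apply: (@good_mono (less T S)) => [? [] //|].
  apply: (@good_V _ _ _ m a a' m' (1 - 2 * a2) (2 * (1 - b2))) => //; try by [lra | exact: nesym].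
  - by rewrite segarc_rev.
  - by move=> x h; apply/HC; left; apply/sA.
  - by move=> x h; apply/HC; right; apply/rv; apply: (sB x).1.
  - by move=> x xS xs /HC [/sA|/rv /((sB x).2 xs)]; auto.
  - by exists w; split=> //; exact: TC.
  - by exists wA; split=> //; exact: TC.
  - by exists wB; split=> //; exact: TC.
apply: (@good_I _ _ _ b' m'); first exact: nesym.
- by move=> x h; apply/HC; right; apply: (sB' x).1; rewrite Rmult_0_r.
- move=> x xS xs /HC [/sA /sub_segarc_opp k|/((sB' x).2 xs)]; last by rewrite Rmult_0_r.
  by case: k => //; lra.
- by exists w', w''; rewrite -ab'; split=> //; exact: TC.
Qed.

(** The case of two edges with both ends in common that form the lens as a whole; each hemisphere
    sees two disjoint chords. *)
Lemma zig_zig_full (C : pt -> Prop) (T : nat -> Prop) :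
  (forall w, T w -> ~ C (cp w)) ->
  (forall x, C x <-> sub (zz s a m b) 0 1 x \/ sub (zz s a' m' b') 0 1 x) ->
  condII T a m m' a' -> good T s C.
Proof.
move=> TC HC [[c1 c2 [w [Tw w1 w2]]] [[wA [TA oA]] [wB [TB oB]]]].
have sA x := @sub_zz_first s a m b 0 1 x mb ltac:(lra) ltac:(lra).
have sB x := @sub_zz_first s a' m' b' 0 1 x mb' ltac:(lra) ltac:(lra).
have rv x : sub (segarc s m' a') 0 1 x <-> sub (segarc s a' m') (2 * 0) 1 x.
  rewrite (sub_rev _ _ x (segarc_rev s m' a')) Rmult_0_r.
  by rewrite Rminus_diag Rminus_0_r.
apply: (@good_II _ _ _ a m m' a') => //; first exact: nesym.
- by move=> x h; apply/HC; left; apply: (sA x).1; rewrite Rmult_0_r.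
- by move=> x /rv h; apply/HC; right; apply: (sB x).1.
- move=> x xS xs /HC [/((sA x).2 xs)|/((sB x).2 xs) /rv]; last by right.
  by rewrite Rmult_0_r; left.
- by exists w; split=> //; exact: TC.
- by exists wA; split=> //; exact: TC.
- by exists wB; split=> //; exact: TC.
Qed.

End ZigZag.

Section ZigZagLens.
Variables (a m b a' m' b' : nat) (s : bool) (C : pt -> Prop) (T : nat -> Prop).
Hypothesis G : apart a m b a' m' b'.

Lemma zz_last t t' : zz s a m b t = zz s a' m' b' t' ->
  zz (~~ s) b m a (1 - t) = zz (~~ s) b' m' a' (1 - t').
Proof. by rewrite !zz_rev negbK. Qed.

Lemma zz_common_two t1 t1' t2 t2' : I01 t1 -> I01 t1' -> I01 t2 -> I01 t2' ->
  zz s a m b t1 = zz s a' m' b' t1' -> zz s a m b t2 = zz s a' m' b' t2' -> t1 <> t2 ->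
  ~ (t1 < 1 / 2 /\ t1' < 1 / 2 /\ t2 < 1 / 2 /\ t2' < 1 / 2) /\
  ~ (1 / 2 < t1 /\ 1 / 2 < t1' /\ 1 / 2 < t2 /\ 1 / 2 < t2').
Proof.
move=> I1 I1' I2 I2' e1 e2 ne; split=> -[? [? [? ?]]]; apply: ne.
  by apply: (zz_first_uniq G _ _ _ _ e1 e2); lra.
have := zz_first_uniq (apart_rev G) _ _ _ _ (zz_last e1) (zz_last e2).
by move=> H; have := H ltac:(lra) ltac:(lra) ltac:(lra) ltac:(lra); lra.
Qed.

(** When both sides run forwards, a common end cannot be a corner, since it is the start of one edge
    and the end of the other. Each pair of halves meets at most once, so the corners are two
    crossings, one in each hemisphere. *)
Lemma zig_zig_same a1 a2 b1 b2 :
  bigon (zz s a m b) (zz s a' m' b') a1 a2 b1 b2 C ->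
  (interlaced a m a' m' -> interlaced b m b' m' ->
   let S w := w = m \/ w = m' in
   condV (less T S) a m a' m' /\ condV (less T S) b m b' m') ->
  good T s C /\ good T (~~ s) C.
Proof.
move=> [ha hb e1 e2 HC] cond.
have [Ia1 Ia2 Ib1 Ib2] : [/\ I01 a1, I01 a2, I01 b1 & I01 b2] by rewrite /I01; split; lra.
have c1 := zz_common G Ia1 Ib1 e1.
have c2 := zz_common G Ia2 Ib2 e2.
have [no1 no2] := zz_common_two Ia1 Ib1 Ia2 Ib2 e1 e2 ltac:(lra).
have [x1 [x2 [x3 x4]]] : (0 < a1 < 1 / 2) /\ (0 < b1 < 1 / 2) /\ (1 / 2 < a2 < 1) /\ (1 / 2 < b2 < 1).
  by lra.
have i1 : interlaced a m a' m' by apply: (zz_first_cross G (t := a1) (t' := b1) _ _ e1); lra.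
have y3 : 0 < 1 - a2 < 1 / 2 by lra.
have y4 : 0 < 1 - b2 < 1 / 2 by lra.
have i2 : interlaced b m b' m'.
  by apply: (zz_first_cross (apart_rev G) y3 _ (zz_last e2)); lra.
have [V1 V2] := cond i1 i2.
have [am [mb [am' [mb' _]]]] := G.
pose S w := w = m \/ w = m'.
have TC w : less T S w -> ~ C (cp w).
  have H := @sub_zz_circle s a m b a1 a2 w am mb ltac:(lra) ltac:(lra).
  have H' := @sub_zz_circle s a' m' b' b1 b2 w am' mb' ltac:(lra) ltac:(lra).
  by move=> [_ h] /HC [/H|/H'] [[_ ?]|[[e _]|[_ ?]]]; try lra; apply: h; [left | right].
split; apply: (@good_mono (less T S)) => [? [] //|].
  by apply: (zz_half_good G TC _ _ _ _ e1 HC V1); lra.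
apply: (zz_half_good (v := 1 - a1) (v' := 1 - b1) (apart_rev G) TC y3 _ y4 _ (zz_last e2) _ V2);
  try by lra.
by move=> x; rewrite HC (sub_rev a1 a2 x (zz_rev s a m b)) (sub_rev b1 b2 x (zz_rev s a' m' b')).
Qed.
End ZigZagLens.

(** With the second side run backwards, two crossings would be met in opposite orders, so at least
    one corner is a common end. The first four conditions treat one common end and a crossing in
    either hemisphere, the last one two common ends. *)
Lemma zig_zig_opp a m b a' m' b' s (C : pt -> Prop) (T : nat -> Prop) a1 a2 b1 b2 :
  apart a m b a' m' b' ->
  bigon (zz s a m b) (zz (~~ s) b' m' a') a1 a2 b1 b2 C ->
  (a = b' -> interlaced a m a' m' ->
   let S w := w = a \/ w = m' in
   condV (less T S) m a a' m' /\ condI (less T S) a m') ->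
  (a = b' -> interlaced b m b' m' ->
   let S w := w = b' \/ w = m in
   condV (less T S) m' b' b m /\ condI (less T S) b' m) ->
  (b = a' -> interlaced a m a' m' ->
   let S w := w = a' \/ w = m in
   condV (less T S) m' a' a m /\ condI (less T S) a' m) ->
  (b = a' -> interlaced b m b' m' ->
   let S w := w = b \/ w = m' in
   condV (less T S) m b b' m' /\ condI (less T S) b m') ->
  (a = b' -> b = a' -> let S w := w = a \/ w = b \/ w = m \/ w = m' in
   condII (less T S) a m m' a' /\ condII (less T S) b m m' b') ->
  good T s C /\ good T (~~ s) C.
Proof.
move=> G B.
have [ha hb e1 e2 HC] := B.
have rev t : zz (~~ s) b' m' a' t = zz s a' m' b' (1 - t) by rewrite zz_rev.
move=> c1 c2 c3 c4 c5.
have [Ia1 Ia2 Ib1 Ib2] : [/\ I01 a1, I01 a2, I01 (1 - b1) & I01 (1 - b2)].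
  by rewrite /I01; split; lra.
have E1 : zz s a m b a1 = zz s a' m' b' (1 - b1) by rewrite e1.
have E2 : zz s a m b a2 = zz s a' m' b' (1 - b2) by rewrite e2.
have k1 := zz_common G Ia1 Ib1 E1.
have k2 := zz_common G Ia2 Ib2 E2.
have [no1 no2] := zz_common_two G Ia1 Ib1 Ia2 Ib2 E1 E2 ltac:(lra).
have flip : good T (~~ s) C /\ good T (~~ ~~ s) C -> good T s C /\ good T (~~ s) C.
  by rewrite negbK => -[].
have Brev : bigon (zz (~~ s) b m a) (zz s a' m' b') (1 - a2) (1 - a1) (1 - b2) (1 - b1) C.
  by apply: (bigon_rev (zz_rev s a m b) _ B) => t; rewrite zz_rev negbK.
have i1 : 0 < a2 < 1 / 2 -> 1 / 2 <= b2 -> interlaced a m a' m'.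
  by move=> h h'; apply: (zz_first_cross G h _ E2); lra.
have i1' : 0 < a1 < 1 / 2 -> 1 / 2 <= b1 -> interlaced a m a' m'.
  by move=> h h'; apply: (zz_first_cross G h _ E1); lra.
have i2 : 1 / 2 < a2 < 1 -> b2 <= 1 / 2 -> interlaced b m b' m'.
  move=> h h'; have := zz_first_cross (apart_rev G) _ _ (zz_last E2).
  by apply; lra.
have i2' : 1 / 2 < a1 < 1 -> b1 <= 1 / 2 -> interlaced b m b' m'.
  move=> h h'; have := zz_first_cross (apart_rev G) _ _ (zz_last E1).
  by apply; lra.
have full : a1 = 0 -> b1 = 0 -> a2 = 1 -> b2 = 1 -> a = b' -> b = a' ->
    good T s C /\ good T (~~ s) C.
  move=> z1 z2 z3 z4 ab ba; have [cs cn] := c5 ab ba.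
  have rv g g' x : (forall t, g (1 - t) = g' t) -> sub g 0 1 x <-> sub g' 0 1 x.
    by move=> /(sub_rev 0 1 x) ->; rewrite Rminus_diag Rminus_0_r.
  have [am [mb [am' [mb' _]]]] := G.
  pose S w := w = a \/ w = b \/ w = m \/ w = m'.
  have TC v : less T S v -> ~ C (cp v).
    have H := @sub_zz_circle s a m b a1 a2 v am mb ltac:(lra) ltac:(lra).
    have H' := @sub_zz_circle (~~ s) b' m' a' b1 b2 v (nesym mb') (nesym am') ltac:(lra) ltac:(lra).
    by move=> [_ h] /HC [/H|/H'] h'; apply: h; rewrite /S; lia.
  split; apply: (@good_mono (less T S)) => [? [] //|];
   [apply: (zig_zig_full G TC _ cs) | apply: (zig_zig_full (apart_rev G) TC _ cn)] => x;
    rewrite HC z1 z2 z3 z4.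
    by rewrite (rv _ _ _ (zz_rev (~~ s) b' m' a')) negbK.
  by rewrite (rv _ _ _ (zz_rev s a m b)).
case: k1 => [k1|[k1|[[z1 [z2 ab]]|[z1 _]]]]; last by exfalso; lra.
- case: k2 => [k2|[k2|[[z1 _]|[z1 [z2 ba]]]]]; try by exfalso; lra.
  have i := i1' ltac:(lra) ltac:(lra); have [cV cI] := c3 ba i.
  have q1 : 1 - a2 = 0 by lra.
  move: (bigon_swap Brev); rewrite q1 z2.
  by move=> B'; apply: (zig_zig_corner (apart_swap G ) B' _ _ cV cI); lra.
- case: k2 => [k2|[k2|[[z1 _]|[z1 [z2 ba]]]]]; try by exfalso; lra.
  have i := i2' ltac:(lra) ltac:(lra); have [cV cI] := c4 ba i.
  have q1 : 1 - a2 = 0 by lra.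
  move: Brev; rewrite q1 z2.
  rewrite -{2}(negbK s) => B'; apply: flip.
  by apply: (zig_zig_corner (apart_rev G ) B' _ _ cV cI); lra.
have b10 : b1 = 0 by lra.
subst a1 b1.
case: k2 => [k2|[k2|[[z3 _]|[z3 [z4 ba]]]]].
- have i := i1 ltac:(lra) ltac:(lra); have [cV cI] := c1 ab i.
  by apply: (zig_zig_corner G B _ _ cV cI); lra.
- have i := i2 ltac:(lra) ltac:(lra); have [cV cI] := c2 ab i.
  move: (bigon_swap B); rewrite -{2}(negbK s) => B'; apply: flip.
  by apply: (zig_zig_corner (apart_swap (apart_rev G) ) B' _ _ cV cI); lra.
- by exfalso; lra.
- by apply: full => //; lra.
Qed.

(** * Every lens contains a vertex *)

Definition isV (n w : nat) : Prop := exists2 v, (v < n)%N & w = (2 * v)%N.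

Definition reaches_vertex (n : nat) (C : pt -> Prop) : Prop :=
  forall y, S2 y -> ~ C y -> exists2 v, (v < n)%N & same_region C y (cp (2 * v)).

(** The equator belongs to both closed hemispheres, so a path in [s] to any of the [2 * n] points
    can be continued to a vertex on the other side. *)
Lemma good_reaches_vertex n s C : good (fun=> True) s C -> good (isV n) (~~ s) C -> reaches_vertex n C.
Proof.
move=> Gs Gn.
have Hn y : hemi (~~ s) y -> ~ C y -> exists2 v, (v < n)%N & same_region C y (cp (2 * v)).
  by move=> hy yC; have [w [[v vn ->] _ yv]] := Gn y hy yC; exists v.
move=> y yS yC; have [s0 hy] := S2_hemi yS.
have [e|ne] := eqVneq s0 s; last by apply: Hn => //; move: ne hy; case: (s) (s0) => -[].
rewrite e in hy.
have [w [_ Cw yw]] := Gs y hy yC.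
have [v vn wv] := Hn _ (hemi_cp _ w) Cw.
by exists v => //; exact: same_region_trans yw wv.
Qed.

Lemma good2_reaches_vertex n s C : good (isV n) s C /\ good (isV n) (~~ s) C -> reaches_vertex n C.
Proof. by case=> G1 G2; apply: (@good_reaches_vertex n s) => //; exact: good_mono G1. Qed.

(** Two common points force two chords of one hemisphere to have the same ends; hence different
    straight edges bound no lens there. *)
Lemma bigon_chords s c d c' d' a1 a2 b1 b2 C : c <> d ->
  bigon (segarc s c d) (segarc s c' d') a1 a2 b1 b2 C ->
  (c = c' \/ c = d') /\ (d = c' \/ d = d').
Proof.
move=> cd [ha hb e1 e2 _].
have Lc t t' : segarc s c d t = segarc s c' d' t' -> L c' d' (seg c d t) = 0.
  by move=> /(congr1 fst) /= ->; exact: L_seg.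
have n12 : a1 <> a2 by lra.
exact: (two_common cd n12 (Lc _ _ e1) (Lc _ _ e2)).
Qed.

Lemma bigon_chords_opp s c d c' d' a1 a2 b1 b2 C : c <> d -> c' <> d' ->
  bigon (segarc s c d) (segarc (~~ s) c' d') a1 a2 b1 b2 C -> c = c' /\ d = d'.
Proof.
move=> cd cd' [ha hb e1 e2 _].
have common t t' : I01 t -> I01 t' -> segarc s c d t = segarc (~~ s) c' d' t' ->
    (t = 0 \/ t = 1) /\ (t' = 0 \/ t' = 1) /\
    (t = 0 -> t' = 0 -> c = c') /\ (t = 1 -> t' = 1 -> d = d').
  move=> It It' e.
  have := segarc_sign s cd It; have := segarc_sign (~~ s) cd' It'; rewrite e sgN.
  case=> [[? ?]|[z0 hc]] [[? ?]|[z0' hz]]; try nra.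
  case: hc hz => -[t0' ->] [] [t0 /cp_inj k];
    (split; [lra | split; [lra |
      by split=> z1 z2; [lra | lra] || (split=> *; [done | lra]) || (split=> *; [lra | done])]]).
have [Ia1 Ia2 Ib1 Ib2] : [/\ I01 a1, I01 a2, I01 b1 & I01 b2] by rewrite /I01; split; lra.
have [p1 [q1 [r1 _]]] := common _ _ Ia1 Ib1 e1.
have [p2 [q2 [_ r2]]] := common _ _ Ia2 Ib2 e2.
by split; [apply: r1 | apply: r2]; lra.
Qed.

Section Lenses.
Variable n : nat.
Hypothesis n4 : (4 <= n)%N.

Local Notation W := (wrap n).

Lemma chord_chord_reaches_vertex s x y a1 a2 b1 b2 C :
  (x + 1 < y)%N -> (y < n)%N -> ~ (x = 0%N /\ y = (n - 1)%N) ->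
  bigon (segarc s (2 * x) (2 * y)) (segarc (~~ s) (2 * x) (2 * y)) a1 a2 b1 b2 C -> reaches_vertex n C.
Proof.
move=> xy yn ns B; apply: (@good2_reaches_vertex n s).
have cI : condI (less (isV n) (fun w => w = (2 * x)%N \/ w = (2 * y)%N)) (2 * x) (2 * y).
  (* The curve separates the vertices between [x] and [y] from the others. The second witness is
     vertex 0, or [n - 1] if 0 is an end; excluding sides makes both witnesses legitimate. *)
  exists (2 * (x + 1))%N, (2 * (if x == 0%N then n - 1 else 0))%N.
  rewrite /less /isV /interlaced /between /outside; split.
  - by split; [exists (x + 1)%N; lia | lia].
  - by split; [exists (if x == 0%N then n - 1 else 0)%N; case: eqP; lia | case: eqP; lia].
  - by case: eqP; lia.
by apply: (chord_chord _ B) => //; lia.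
Qed.


Definition off (a b u t : nat) : bool := [&& u != a, u != b, t != a & t != b].

(** Parity of the separations: for points off the ends it is true exactly if the chord separates [u]
    from [t]. As an exclusive or it behaves well under rotation. *)
Definition sep (a b u t : nat) : bool :=
  (a < u)%N (+) (b < u)%N (+) (a < t)%N (+) (b < t)%N.

Lemma interlacedE a b u t : interlaced a b u t <-> off a b u t && sep a b u t.
Proof.
split=> [|/andP[/and4P[? ? ? ?]]]; last by rewrite /interlaced /between /outside /sep; lia.
by rewrite /interlaced /between /outside /sep /off => h; apply/andP; split; [apply/and4P; split|]; lia.
Qed.

Lemma same_sideE a b u t : same_side a b u t <-> off a b u t && ~~ sep a b u t.
Proof.
split=> [|/andP[/and4P[? ? ? ?]]]; last by rewrite /same_side /between /outside /sep; lia.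
by rewrite /same_side /between /outside /sep /off => h; apply/andP; split; [apply/and4P; split|]; lia.
Qed.

Section Rotation.
Variable i : nat.
Hypothesis ni : (i < n)%N.

(* Being separated by a chord is invariant under rotation, so it can be tested for i = 0. *)
Definition rot (x : nat) : nat := W (2 * i + x).

Lemma rot_lt x : (x < 2 * n)%N -> (rot x < 2 * n)%N.
Proof. by rewrite /rot; wr. Qed.

Lemma rot_inj x y : (x < 2 * n)%N -> (y < 2 * n)%N -> rot x = rot y -> x = y.
Proof. by rewrite /rot; wr. Qed.

Lemma rot_surj x : (x < 2 * n)%N -> exists2 y, (y < 2 * n)%N & x = rot y.
Proof.
move=> xn; exists (if (x < 2 * i)%N then x + 2 * n - 2 * i else x - 2 * i)%N; first by case: ifP; lia.
by rewrite /rot; case: ifP => h; wr.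
Qed.

Lemma rot_even x : (x < 2 * n)%N -> odd (rot x) = odd x.
Proof. by rewrite /rot; wr. Qed.

Lemma rot_isV x : (x < 2 * n)%N -> ~~ odd x -> isV n (rot x).
Proof.
by move=> xn ex; exists (rot x)./2; have := rot_lt xn; have := rot_even xn; lia.
Qed.

Lemma rot_ltn x y : (x < 2 * n)%N -> (y < 2 * n)%N -> x <> y ->
  (rot x < rot y)%N = (x < y)%N (+) (2 * n <= 2 * i + x)%N (+) (2 * n <= 2 * i + y)%N.
Proof. by rewrite /rot; wr. Qed.

(** By [rot_ltn] a comparison changes by the wrap-around bits of its two arguments; each of the four
    points enters two of the comparisons in [sep], so these bits cancel. *)
Lemma rot_sep x y u t : (x < 2 * n)%N -> (y < 2 * n)%N -> (u < 2 * n)%N -> (t < 2 * n)%N ->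
  off (rot x) (rot y) (rot u) (rot t) = off x y u t /\
  (off x y u t -> sep (rot x) (rot y) (rot u) (rot t) = sep x y u t).
Proof.
move=> xn yn un tn; split.
  have eq a b : (a < 2 * n)%N -> (b < 2 * n)%N -> (rot a != rot b) = (a != b).
    by move=> an bn; congr (~~ _); apply/eqP/eqP => [|->//]; exact: rot_inj.
  by rewrite /off !eq.
move=> /and4P[/eqP ux /eqP uy /eqP tx /eqP ty].
rewrite /sep !rot_ltn //; try exact: nesym.
by do 4 case: (2 * n <= _)%N; do 4 case: (_ < _)%N.
Qed.

Lemma rot_interlaced x y u t : (x < 2 * n)%N -> (y < 2 * n)%N -> (u < 2 * n)%N -> (t < 2 * n)%N ->
  (interlaced (rot x) (rot y) (rot u) (rot t) <-> interlaced x y u t).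
Proof.
move=> xn yn un tn; rewrite !interlacedE.
have [-> h] := rot_sep xn yn un tn.
by case: (off x y u t) h => //= ->.
Qed.

Lemma rot_same_side x y u t : (x < 2 * n)%N -> (y < 2 * n)%N -> (u < 2 * n)%N -> (t < 2 * n)%N ->
  (same_side (rot x) (rot y) (rot u) (rot t) <-> same_side x y u t).
Proof.
move=> xn yn un tn; rewrite !same_sideE.
have [-> h] := rot_sep xn yn un tn.
by case: (off x y u t) h => //= ->.
Qed.

Definition onrot (T : nat -> Prop) (w : nat) : Prop := (w < 2 * n)%N /\ T (rot w).

Lemma rot_condV T a m c q : (a < 2 * n)%N -> (m < 2 * n)%N -> (c < 2 * n)%N -> (q < 2 * n)%N ->
  condV (onrot T) a m c q -> condV T (rot a) (rot m) (rot c) (rot q).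
Proof.
move=> an mn cn qn [[w [[wn Tw] w1 w2]] [wA [[An TA] oA]] [wB [[Bn TB] oB]]]; split.
- by exists (rot w); split=> //; apply/rot_same_side.
- by exists (rot wA); split=> //; apply/rot_interlaced.
- by exists (rot wB); split=> //; apply/rot_interlaced.
Qed.

Lemma rot_condI T a b : (a < 2 * n)%N -> (b < 2 * n)%N ->
  condI (onrot T) a b -> condI T (rot a) (rot b).
Proof.
move=> an bn [w [w' [[wn Tw] [wn' Tw'] o]]].
by exists (rot w), (rot w'); split=> //; apply/rot_interlaced.
Qed.

Lemma rot_condII T a b c d :
  (a < 2 * n)%N -> (b < 2 * n)%N -> (c < 2 * n)%N -> (d < 2 * n)%N ->
  condII (onrot T) a b c d -> condII T (rot a) (rot b) (rot c) (rot d).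
Proof.
move=> an bn cn dn [[c1 c2 [w [[wn Tw] w1 w2]]] [[wA [[An TA] oA]] [wB [[Bn TB] oB]]]].
split; first split; try exact/rot_same_side.
  by exists (rot w); split=> //; apply/rot_same_side.
by split; [exists (rot wA) | exists (rot wB)]; split=> //; apply/rot_interlaced.
Qed.

Lemma rot0 : rot 0 = (2 * i)%N.
Proof. by rewrite /rot; wr. Qed.

Lemma rot_rot j x y : (2 * j)%N = rot x -> (x < 2 * n)%N -> (y <= 6)%N ->
  W (2 * j + y) = rot (W (x + y)).
Proof. by move=> -> xn y6; rewrite /rot; wr. Qed.

Lemma rot_neq x y : (x < 2 * n)%N -> (y < 2 * n)%N -> x <> y -> rot x <> rot y.
Proof. by move=> xn yn ne /(rot_inj xn yn). Qed.

Lemma onrotP (S : nat -> Prop) w : (w < 2 * n)%N -> ~~ odd w -> ~ S (rot w) ->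
  onrot (less (isV n) S) w.
Proof. by move=> wn ew h; split=> //; split=> //; exact: rot_isV. Qed.

(** After rotation the bent edge runs through 0, 3, 6. For a northern chord the lens runs to 6 and
    the chord comes from 0 or 2; for a southern one everything is reversed, and the chord runs to 0
    from 6 or 4. *)
Lemma zig_chord_reaches_vertex s k k' a1 a2 b1 b2 C : (k < n)%N -> (k' < n)%N -> k <> k' ->
  bigon (zz true (2 * i) (W (2 * i + 3)) (W (2 * i + 6))) (segarc s (2 * k) (2 * k'))
    a1 a2 b1 b2 C -> reaches_vertex n C.
Proof.
move=> nk nk' kk B.
have [h1 h2 h3] := zig_neq n4 ni.
have o1 : W (2 * i + 3) <> (2 * k)%N by wr.
have o2 : W (2 * i + 3) <> (2 * k')%N by wr.
have kk2 : (2 * k)%N <> (2 * k')%N by lia.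
have n0 : (0 < 2 * n)%N by lia.
have n3 : (3 < 2 * n)%N by lia.
have n6 : (6 < 2 * n)%N by lia.
move: h1 h2 h3 o1 o2 B; rewrite -/(rot 3) -/(rot 6) -rot0 => h1 h2 h3 o1 o2 B.
case: s B => B.
  have [c cn cE] := @rot_surj (2 * k) ltac:(lia).
  have ec : ~~ odd c by rewrite -rot_even // -cE; lia.
  rewrite cE in o1 kk2 B.
  have [] := zig_chord (T := fun=> True) (T' := isV n) h1 h2 h3 kk2 o1 o2 B; last exact: good_reaches_vertex.
  move=> db fact S.
  have {}cE : c = 0%N \/ c = 2%N.
    case: fact => [/(rot_inj cn n0)|/rot_interlaced h]; first by left.
    by move: (h n0 n3 cn n6); rewrite /interlaced /between /outside; lia.
  have SE w : (w < 2 * n)%N -> ~ (w = 3%N \/ w = 6%N \/ w = 0%N /\ c = 0%N) -> ~ S (rot w).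
    by move=> wn h [/(rot_inj wn n3)|[/(rot_inj wn n6)|[/(rot_inj wn n0) ? /(rot_inj cn n0)]]];
      lia.
  split; [apply: rot_condV => // | apply: rot_condI => //].
    (* The target 7 is odd, so no vertex. For [n = 4] and [c = 0] it is the only point beyond the
       chord from 0 to 6, which is why [T] is everything and the path goes on in the south. *)
    split; [exists 4%N | exists 2%N | exists 7%N]; split;
      try (by rewrite /same_side /interlaced /between /outside; lia);
      by split; [lia | split=> //; apply: SE; lia].
  by exists 4%N, 2%N; split; [| | rewrite /interlaced /between /outside; lia];
    apply: onrotP => //; try apply: SE; lia.
have [c cn cE] := @rot_surj (2 * k') ltac:(lia).
have ec : ~~ odd c by rewrite -rot_even // -cE; lia.
have kk2' := nesym kk2; rewrite cE in o2 kk2' B.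
have [] := zig_chord (T := fun=> True) (T' := isV n) (nesym h2) (nesym h1) (nesym h3) kk2' o2 o1
  (bigon_rev (zz_rev _ _ _ _) (segarc_rev _ _ _) B); last exact: good_reaches_vertex.
move=> db fact S.
have {}cE : c = 6%N \/ c = 4%N.
  case: fact => [/(rot_inj cn n6)|/rot_interlaced h]; first by left.
  by move: (h n6 n3 cn n0); rewrite /interlaced /between /outside; lia.
have SE w : (w < 2 * n)%N -> ~ (w = 3%N \/ w = 0%N \/ w = 6%N /\ c = 6%N) -> ~ S (rot w).
  by move=> wn h [/(rot_inj wn n3)|[/(rot_inj wn n0)|[/(rot_inj wn n6) ? /(rot_inj cn n6)]]];
    lia.
split; [apply: rot_condV => // | apply: rot_condI => //].
  split; [exists 2%N | exists 4%N | exists 7%N]; split;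
    try (by rewrite /same_side /interlaced /between /outside; lia);
    by split; [lia | split=> //; apply: SE; lia].
by exists 2%N, 4%N; split; [| | rewrite /interlaced /between /outside; lia];
  apply: onrotP => //; try apply: SE; lia.
Qed.

Ltac vertex w := exists w; split; try (by rewrite /same_side /interlaced /between /outside; lia);
  try (by apply: onrotP; [lia | lia | first
    [ move=> [|]; apply: rot_neq; lia | move=> [|[|[|]]]; apply: rot_neq; lia ]]).

Section TwoZigs.
Variable j : nat.
Hypotheses (nj : (j < n)%N) (ij : i <> j).

Lemma zig_zig_offset : exists x, [/\ (x < 2 * n)%N, ~~ odd x, x <> 0%N, (2 * j)%N = rot x
  & W (2 * j + 3) = rot (W (x + 3)) /\ W (2 * j + 6) = rot (W (x + 6))].
Proof.
have [x xn xE] := @rot_surj (2 * j) ltac:(lia).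
exists x; split=> //.
- by rewrite -rot_even // -xE; lia.
- by move=> x0; move: xE; rewrite x0 rot0; lia.
- by split; apply: rot_rot.
Qed.

Lemma wrap_lt x k : (x < 2 * n)%N -> (k <= 6)%N -> (W (x + k) < 2 * n)%N.
Proof. by wr. Qed.

Lemma rot_apart x : (x < 2 * n)%N -> ~~ odd x -> x <> 0%N ->
  apart (rot 0) (rot 3) (rot 6) (rot x) (rot (W (x + 3))) (rot (W (x + 6))).
Proof.
move=> xn ex x0; have l3 := @wrap_lt x 3 xn isT; have l6 := @wrap_lt x 6 xn isT.
by rewrite /apart; (repeat split); apply: rot_neq; try lia; wr.
Qed.

Lemma zig_zig_same_reaches_vertex a1 a2 b1 b2 C :
  bigon (zz true (2 * i) (W (2 * i + 3)) (W (2 * i + 6)))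
        (zz true (2 * j) (W (2 * j + 3)) (W (2 * j + 6))) a1 a2 b1 b2 C -> reaches_vertex n C.
Proof.
have [x [xn ex x0 -> [-> ->]]] := zig_zig_offset.
rewrite -/(rot 3) -/(rot 6) -rot0 => B.
have G := rot_apart xn ex x0.
have l3 := @wrap_lt x 3 xn isT; have l6 := @wrap_lt x 6 xn isT.
have n0 : (0 < 2 * n)%N by lia.
have n3 : (3 < 2 * n)%N by lia.
have n6 : (6 < 2 * n)%N by lia.
apply: (@good2_reaches_vertex n true); apply: (zig_zig_same G B) => /rot_interlaced h _ S.
have {h} [xE|xE] : x = 2%N \/ x = (2 * n - 2)%N.
- by move: (h n0 n3 xn l3); rewrite /interlaced /between /outside; wr.
- have e3 : W (x + 3) = 5%N by rewrite xE; wr.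
  have e6 : W (x + 6) = 8%N /\ (8 < 2 * n)%N \/ W (x + 6) = 0%N /\ n = 4%N by rewrite xE; wr.
  rewrite /S; move: l3; rewrite e3 => l3.
  by split; apply: rot_condV => //; split;
    [vertex 4%N | vertex 2%N | vertex 0%N | vertex 4%N | vertex 2%N | vertex 6%N].
have e3 : W (x + 3) = 1%N by rewrite xE; wr.
have e6 : W (x + 6) = 4%N by rewrite xE; wr.
rewrite /S; move: l3 l6; rewrite e3 e6 => l3 l6.
split; apply: rot_condV => //; split.
- vertex 2%N.
- vertex x.
- vertex 0%N.
- vertex 2%N.
- vertex 4%N.
- vertex 0%N.
Qed.

(** Modulo [n], a common end means that [i] and [j] differ by 3, a crossing that they differ by 1.
    Both together force [n = 4], and two common ends force [n = 6], so explicit vertices can be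
    named. *)
Lemma zig_zig_opp_reaches_vertex a1 a2 b1 b2 C :
  bigon (zz true (2 * i) (W (2 * i + 3)) (W (2 * i + 6)))
        (zz false (W (2 * j + 6)) (W (2 * j + 3)) (2 * j)) a1 a2 b1 b2 C -> reaches_vertex n C.
Proof.
have [x [xn ex x0 -> [-> ->]]] := zig_zig_offset.
rewrite -/(rot 3) -/(rot 6) -rot0 => B.
have G := rot_apart xn ex x0.
have l3 := @wrap_lt x 3 xn isT; have l6 := @wrap_lt x 6 xn isT.
have n0 : (0 < 2 * n)%N by lia.
have n3 : (3 < 2 * n)%N by lia.
have n6 : (6 < 2 * n)%N by lia.
apply: (@good2_reaches_vertex n true); apply: (zig_zig_opp (s := true) G B).
- move=> /(rot_inj n0 l6) e /rot_interlaced h S.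
  have [nE xE] : n = 4%N /\ x = 2%N.
    by move: e (h n0 n3 xn l3); rewrite /interlaced /between /outside; wr.
  have e3 : W (x + 3) = 5%N by rewrite xE; wr.
  rewrite /S; move: l3; rewrite e3 => l3.
  split; [apply: rot_condV => //; split | apply: rot_condI => //].
  + vertex 6%N.
  + vertex 2%N.
  + vertex 4%N.
  + by exists 2%N; vertex 6%N.
- move=> /(rot_inj n0 l6) e /rot_interlaced h S.
  have [nE xE] : n = 4%N /\ x = 2%N.
    by move: e (h n6 n3 l6 l3); rewrite /interlaced /between /outside; wr.
  have e3 : W (x + 3) = 5%N by rewrite xE; wr.
  rewrite /S; move: l3; rewrite e3 -e => l3.
  split; [apply: rot_condV => //; split | apply: rot_condI => //].
  + vertex 2%N.
  + vertex 6%N.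
  + vertex 4%N.
  + by exists 2%N; vertex 4%N.
- move=> /(rot_inj n6 xn) e /rot_interlaced h S.
  have nE : n = 4%N.
    by move: e (h n0 n3 xn l3); rewrite /interlaced /between /outside; wr.
  have e3 : W (x + 3) = 1%N by rewrite -e; wr.
  rewrite /S; move: l3; rewrite e3 -e => l3.
  split; [apply: rot_condV => //; split | apply: rot_condI => //].
  + vertex 4%N.
  + vertex 0%N.
  + vertex 2%N.
  + by exists 2%N; vertex 4%N.
- move=> /(rot_inj n6 xn) e /rot_interlaced h S.
  have nE : n = 4%N.
    by move: e (h n6 n3 l6 l3); rewrite /interlaced /between /outside; wr.
  have e3 : W (x + 3) = 1%N by rewrite -e; wr.
  have e6 : W (x + 6) = 4%N by rewrite -e; wr.
  rewrite /S; move: l3 l6; rewrite e3 e6 => l3 l6.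
  split; [apply: rot_condV => //; split | apply: rot_condI => //].
  + vertex 0%N.
  + vertex 4%N.
  + vertex 2%N.
  + by exists 2%N; vertex 0%N.
move=> /(rot_inj n0 l6) e /(rot_inj n6 xn) e' S.
have nE : n = 6%N by move: e; rewrite -e'; wr.
have e3 : W (x + 3) = 9%N by rewrite -e'; wr.
rewrite /S; move: l3; rewrite e3 -e -e' => l3.
split; apply: rot_condII => //; split; [split | split | split | split].
- by rewrite /same_side /between /outside; lia.
- by rewrite /same_side /between /outside; lia.
- vertex 4%N.
- vertex 2%N.
- vertex 8%N.
- by rewrite /same_side /between /outside; lia.
- by rewrite /same_side /between /outside; lia.
- vertex 8%N.
- vertex 4%N.
- vertex 10%N.
Qed.
End TwoZigs.
End Rotation.

(** The two sides of a lens may meet the corners in opposite orders; running one of them backwards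
    restores the orientation required by [bigon]. *)
Definition back (d : desc) : R -> pt :=
  match d with
  | inl (s, (a, b)) => segarc s (2 * b) (2 * a)
  | inr i => zz false (W (2 * i + 6)) (W (2 * i + 3)) (2 * i)
  end.

Lemma arcd_back d t : arcd n d (1 - t) = back d t.
Proof. by case: d => [[s [a b]]|i]; [exact: segarc_rev | exact: zz_rev]. Qed.

Lemma bigon_reaches_vertex d d' a1 a2 b1 b2 C : wf_desc n d -> wf_desc n d' -> d <> d' ->
  bigon (arcd n d) (arcd n d') a1 a2 b1 b2 C \/ bigon (arcd n d) (back d') a1 a2 b1 b2 C ->
  reaches_vertex n C.
Proof.
case: d => [[s [x y]]|i]; case: d' => [[s' [x' y']]|j] w w' ne B.
- case: w w' => xy yn _ ns [xy' yn' _ ns'].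
  have d1 : (2 * x)%N <> (2 * y)%N by lia.
  have d2 : (2 * x')%N <> (2 * y')%N by lia.
  have [e|es] := eqVneq s' s.
    move: B ne; rewrite /arcd /back e => -[] /(bigon_chords d1) k ne;
      by case: ne; congr (inl (_, (_, _))); lia.
  have e : s' = ~~ s by move: es; case: (s) (s') => -[].
  move: B; rewrite /arcd /back e => -[] B.
    have [e1 e2] := bigon_chords_opp d1 d2 B.
    apply: (@chord_chord_reaches_vertex s x y a1 a2 b1 b2); try by move: ns ns' e; case: s {B es ne}; lia.
    by rewrite {2}e1 {2}e2.
  by have [e1 e2] := bigon_chords_opp d1 (fun k => d2 (esym k)) B; exfalso; lia.
- case: w => xy yn _ _; case: B => /bigon_swap B.
    by apply: (zig_chord_reaches_vertex w' _ _ _ B); lia.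
  have B' := bigon_rev (zz_rev _ _ _ _) (segarc_rev _ _ _) B.
  by apply: (zig_chord_reaches_vertex w' _ _ _ B'); lia.
- case: w' => xy yn _ _; case: B => B.
    by apply: (zig_chord_reaches_vertex w _ _ _ B); lia.
  by apply: (zig_chord_reaches_vertex w _ _ _ B); lia.
- have ij : i <> j by move=> e; apply: ne; rewrite e.
  by case: B => B; [exact: (zig_zig_same_reaches_vertex w w' ij B) | exact: (zig_zig_opp_reaches_vertex w w' ij B)].
Qed.
End Lenses.

(** * The graph *)

(** The diagonals of step two at 0, 1, [n - 2] and [n - 1] that would be missing from the last list,
    cyclically, already belong to the fans at 0 and 1. The count is
    [(n - 3) + (n - 3) + (n - 4)]. *)
Definition diagonals (s : bool) (n : nat) : seq desc :=
  [seq inl (s, (0%N, b)) | b <- iota 2 (n - 3)] ++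
  [seq inl (s, (1%N, b)) | b <- iota 3 (n - 3)] ++
  [seq inl (s, (a, (a + 2)%N)) | a <- iota 2 (n - 4)].

Definition edges (n : nat) : seq desc :=
  [seq inl (true, (a, (a + 1)%N)) | a <- iota 0 (n - 1)] ++
  inl (true, (0%N, (n - 1)%N)) :: diagonals true n ++ diagonals false n ++
  [seq inr i | i <- iota 0 n].

Section Graph.
Variable n : nat.
Hypothesis n4 : (4 <= n)%N.

Lemma size_edges : size (edges n) = (8 * n - 20)%N.
Proof. by rewrite /edges /diagonals !(size_cat, size_map, size_iota) /= !(size_cat, size_map, size_iota); lia. Qed.

Lemma diagonals_mem s d : d \in diagonals s n -> exists x y, d = inl (s, (x, y)) /\
  [/\ (x + 1 < y)%N, (y < n)%N, (x <= 1 \/ y = x + 2)%N & ~ (x = 0%N /\ y = (n - 1)%N)].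
Proof.
rewrite /diagonals !mem_cat => /or3P[] /mapP [k]; rewrite mem_iota => hk ->;
  eexists; eexists; split; first reflexivity; split; lia.
Qed.

Lemma diagonals_uniq s : uniq (diagonals s n).
Proof.
rewrite /diagonals !cat_uniq !map_inj_uniq ?iota_uniq /=; try by move=> ? ? [] *; lia.
rewrite andbT; apply/andP; split; apply/hasPn => d; rewrite ?mem_cat.
  move=> /orP[] /mapP [k]; rewrite mem_iota => hk ->; apply/mapP => -[k' _ []]; lia.
by move=> /mapP [k]; rewrite mem_iota => hk ->; apply/mapP => -[k' _ []]; lia.
Qed.

Lemma edges_uniq : uniq (edges n).
Proof.
rewrite /edges.
move: (diagonals_uniq true) (diagonals_uniq false) (@diagonals_mem true) (@diagonals_mem false).
move: (diagonals true n) (diagonals false n) => dt df ut uf mt mf.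
rewrite cat_uniq /= !cat_uniq ut uf !map_inj_uniq ?iota_uniq /=; try by move=> ? ? []; lia.
rewrite !andbT negb_or !mem_cat !negb_or -!andbA; apply/and5P; split.
- by apply/mapP => -[k]; rewrite mem_iota => hk []; lia.
- apply/hasPn => d; rewrite !mem_cat => /or3P[/mt|/mf|/mapP [k _]].
  + by move=> [x [y [-> [? ? ? ?]]]]; apply/mapP => -[k _ []]; lia.
  + by move=> [x [y [-> _]]]; apply/mapP => -[].
  + by move=> ->; apply/mapP => -[].
- by apply/negP => /mt [x [y [[<- <-] [_ _ _]]]]; case.
- by apply/negP => /mf [x [y []]].
apply/and3P; split.
- by apply/mapP => -[].
- apply/hasPn => d; rewrite mem_cat => /orP[/mf|/mapP [k _ ->]].
    by move=> [x [y [-> _]]]; apply/negP => /mt [x' [y' []]].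
  by apply/negP => /mt [x' [y' []]].
- by apply/hasPn => d /mapP [k _ ->]; apply/negP => /mf [x' [y' []]].
Qed.

Lemma edges_wf d : d \in edges n -> wf_desc n d.
Proof.
rewrite /edges; move: (@diagonals_mem true d) (@diagonals_mem false d).
move: (diagonals true n) (diagonals false n) => dt df mt mf.
rewrite mem_cat inE !mem_cat => /orP[/mapP [k]|/or4P[/eqP ->|/mt|/mf|/mapP [k]]].
- by rewrite mem_iota => hk -> /=; split; lia.
- by split; lia.
- by move=> [x [y [-> [? ? ? ?]]]] /=; split=> //; lia.
- by move=> [x [y [-> [? ? ? ?]]]] /=; split=> //; lia.
- by rewrite mem_iota => hk -> /=; lia.
Qed.

Lemma dends_lt d : wf_desc n d -> ((dends n d).1 < n)%N /\ ((dends n d).2 < n)%N.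
Proof.
case: d => [[s [a b]]|i] /= w; first by case: w; lia.
by rewrite ltn_mod; lia.
Qed.

Lemma dends_neq d : wf_desc n d -> (dends n d).1 <> (dends n d).2.
Proof.
case: d => [[s [a b]]|i] /= w; first by case: w; lia.
by have := wrap6 n4 w; have [_ _] := zig_neq n4 w; lia.
Qed.
End Graph.

Local Close Scope R_scope.

Theorem theorem23 (n : nat) :
  4 <= n ->
  exists ends : 'I_(8 * n - 20) -> 'I_n * 'I_n,
    loopless ends /\ mconnected ends /\
    exists (vpos : 'I_n -> pt) (arc : 'I_(8 * n - 20) -> R -> pt),
      is_drawing ends vpos arc /\ quasiplanar arc /\ non_homotopic vpos arc.
Proof.
move=> n4; have n0 : (0 < n)%N by lia.
pose v k : 'I_n := Ordinal (ltn_pmod k n0).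
(* The default [inr 0] is never returned: the list has exactly [8 * n - 20] members. *)
pose D (e : 'I_(8 * n - 20)) : desc := nth (inr 0%N) (edges n) e.
have De e : D e \in edges n by apply: mem_nth; rewrite size_edges.
have Dw e : wf_desc n (D e) by exact: edges_wf (De e).
have Dinj e f : D e = D f -> e = f.
  move=> /eqP; rewrite nth_uniq ?size_edges ?edges_uniq //.
  by move=> /eqP ef; exact: ord_inj.
have Dsurj d : d \in edges n -> exists e, D e = d.
  move=> dn; have dl : (index d (edges n) < 8 * n - 20)%N by rewrite -size_edges // index_mem.
  by exists (Ordinal dl); rewrite /D /= nth_index.
have Dne e f : e <> f -> D e <> D f by move=> ef /Dinj.
exists (fun e => (v (dends n (D e)).1, v (dends n (D e)).2)).
split; [|split].
- move=> e /(congr1 (@nat_of_ord n)) /=.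
  have [l1 l2] := dends_lt n4 (Dw e).
  by rewrite !modn_small //; exact: (dends_neq n4 (Dw e)).
- have sym x y : adj (fun e => (v (dends n (D e)).1, v (dends n (D e)).2)) x y =
      adj (fun e => (v (dends n (D e)).1, v (dends n (D e)).2)) y x.
    by apply/existsP/existsP => -[e he]; exists e; rewrite orbC.
  have csym := sym_connect_sym sym.
  have c0 k : (k < n)%N ->
      connect (adj (fun e => (v (dends n (D e)).1, v (dends n (D e)).2))) (v 0%N) (v k).
    elim: k => [|k IH] kn; first exact: connect0.
    apply: connect_trans (IH ltac:(lia)) (connect1 _).
    (* Connectivity comes from the path formed by the northern sides. *)
    have [e eD] : exists e, D e = inl (true, (k, (k + 1)%N)).
      apply: Dsurj; rewrite mem_cat; apply/orP; left; apply/mapP.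
      by exists k => //; rewrite mem_iota; lia.
    by apply/existsP; exists e; rewrite eD /= addn1 eqxx.
  move=> x y; have vx (z : 'I_n) : z = v z by apply: ord_inj; rewrite /= modn_small.
  rewrite (vx x) (vx y); apply: connect_trans (c0 _ (ltn_ord y)).
  by rewrite csym; exact: c0.
exists (fun w => cp (2 * w)), (fun e => arcd n (D e)).
have cross_d e f : cross (fun e => arcd n (D e)) e f -> desc_cross n (D e) (D f).
  by move=> [x [ef [xe xf]]]; exact: (common_desc_cross n4 (Dw e) (Dw f) (Dne _ _ ef) xe xf).
have qp : quasiplanar (fun e => arcd n (D e)).
  move=> e f g [/cross_d ef [/cross_d fg /cross_d eg]].
  exact: (desc_cross_triple n4 (Dw e) (Dw f) (Dw g) ef fg eg).
split; [|split=> //].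
- split; [|split; [|split; [|split; [|split; [|split]]]]].
  + by move=> w; exact: (hemi_cp true _).1.
  + by move=> x y /cp_inj xy; apply: ord_inj; lia.
  + move=> e; have [l1 l2] := dends_lt n4 (Dw e).
    by rewrite /= !modn_small //; exact: arcd_jordan.
  + by move=> e w t t01; exact: arcd_avoids.
  + by move=> e f ef; exact: (arcd_finite n4 (Dw e) (Dw f) (Dne _ _ ef)).
  + by move=> e f x ef; exact: (arcd_proper n4 (Dw e) (Dw f) (Dne _ _ ef)).
  + move=> e f g x ef fg eg [xe [xf xg]].
    by apply: (qp e f g); split; [|split]; exists x.
move=> C [e [f [a1 [a2 [b1 [b2 [ef [h1 [h2 [h3 [h4 [h5 [h6 [hc [_ HC]]]]]]]]]]]]]]] y yS yC.
have V : reaches_vertex n C.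
  case: hc => -[e1 e2].
    by apply: (@bigon_reaches_vertex _ n4 _ _ a1 a2 b1 b2 C (Dw e) (Dw f) (Dne _ _ ef)); left; split.
  apply: (@bigon_reaches_vertex _ n4 _ _ a1 a2 (1 - b2) (1 - b1) C (Dw e) (Dw f) (Dne _ _ ef)).
  right; split=> //; try lra.
  - by rewrite -arcd_back e1; congr (arcd n (D f)); ring.
  - by rewrite -arcd_back e2; congr (arcd n (D f)); ring.
  - by move=> x; rewrite -(sub_rev b1 b2 x (arcd_back n (D f))); exact: HC.
have [w wn yw] := V y yS yC.
exists (cp (2 * w)); split=> //; left.
by exists (Ordinal wn).
Qed.
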